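(* Suppose $2\mu\bar c\le\sigma^2 r$. Then $V(x,c)=\frac{\bar c}{r}(1-e^{-\gamma x})$ for all $(x,c)\in[0,\infty)\times[0,\bar c]$, and the constant strategy $C^*_t\equiv\bar c$ is optimal for every initial $(x,c)$.
   Context: Fix a filtered probability space $(\Omega,\mathcal F,(\mathcal F_t)_{t\ge0},\mathbb P)$ carrying a standard one-dimensional Brownian motion $W$, with $(\mathcal F_t)$ the augmented natural filtration of $W$. Constants: $\mu\in\mathbb R$, $\sigma>0$, $r>0$, $\bar c\in(0,\mu]$, $b\in[0,1]$. For an adapted dividend-rate process $C$ and $x\ge0$, the surplus is $X_t=x+\int_0^t(\mu-C_s)ds+\sigma W_t$ and the ruin time is $\tau=\inf\{t\ge0:X_t\le0\}$ ($\inf\emptyset=+\infty$). Given $c\in[0,\bar c]$, the running maximum is $M_t=\max\{c,\sup_{0\le s\le t}C_s\}$. $\Pi_{[c,\bar c]}$ denotes the set of adapted càdlàg processes $C$ with $bM_t\le C_t\le\bar c$ for $0\le t\le\tau$, and $V(x,c)=\sup_{C\in\Pi_{[c,\bar c]}}\mathbb E[\int_0^\tau e^{-rt}C_t\,dt]$. $\gamma=\frac{\sqrt{(\mu-\bar c)^2+2\sigma^2 r}+(\mu-\bar c)}{\sigma^2}$. *)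

(* Defs.v *)
From HB Require Import structures.
From mathcomp Require Import all_boot all_order all_algebra.
From mathcomp Require Import all_classical all_reals all_analysis.

Set Implicit Arguments.
Unset Strict Implicit.
Unset Printing Implicit Defensive.

Import Order.TTheory GRing.Theory Num.Def Num.Theory.
Import numFieldNormedType.Exports.

Local Open Scope classical_set_scope.
Local Open Scope ring_scope.

Section dividend_model.
Context {R : realType} {d : measure_display} {Omega : measurableType d}.
Variable P : probability Omega R.

Definition indep_of (G : set (set Omega)) (X : Omega -> R) : Prop :=
  forall (A : set Omega) (B : set R), G A -> measurable B ->
    P (A `&` X @^-1` B) = (P A * P (X @^-1` B))%E.

Definition natural_gen (W : R -> Omega -> R) (t : R) : set (set Omega) :=
  [set A | exists s (B : set R), [/\ 0 <= s <= t, measurable B & A = W s @^-1` B]].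

Definition natural_sigma (W : R -> Omega -> R) (t : R) : set (set Omega) :=
  <<s natural_gen W t >>.

Definition null_events : set (set Omega) :=
  [set N | measurable N /\ P N = 0%E].

Definition aug_filtration (W : R -> Omega -> R) (t : R) : set (set Omega) :=
  <<s natural_gen W t `|` null_events >>.

Definition standard_BM (W : R -> Omega -> R) : Prop :=
  [/\ (forall t, 0 <= t -> measurable_fun setT (W t)),
      (forall w, W 0 w = 0),
      (forall w, {within `[0, +oo[, continuous (fun t => W t w)}) &
      (forall s t, 0 <= s -> s < t ->
         indep_of (natural_sigma W s) (fun w => W t w - W s w) /\
         forall B : set R, measurable B ->
           P ((fun w => W t w - W s w) @^-1` B) = normal_prob 0 (Num.sqrt (t - s)) B)].

Definition adapted (F : R -> set (set Omega)) (C : R -> Omega -> R) : Prop :=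
  forall t, 0 <= t -> forall B : set R, measurable B -> F t (C t @^-1` B).

Definition cadlag (f : R -> R) : Prop :=
  forall t, 0 <= t ->
    (f s @[s --> t^'+] --> f t) /\ (0 < t -> exists l : R, f s @[s --> t^'-] --> l).

Definition surplus (W : R -> Omega -> R) (mu sigma x : R) (C : R -> Omega -> R)
  (t : R) (w : Omega) : R :=
  x + Rintegral lebesgue_measure `[0, t] (fun s => mu - C s w) + sigma * W t w.

(* ruin time tau = inf {t >= 0 : X_t <= 0}, inf of the empty set = +oo *)
Definition ruin_time (W : R -> Omega -> R) (mu sigma x : R) (C : R -> Omega -> R)
  (w : Omega) : \bar R :=
  ereal_inf [set t%:E | t in [set t : R | 0 <= t /\ surplus W mu sigma x C t w <= 0]].

Definition running_max (c : R) (C : R -> Omega -> R) (t : R) (w : Omega) : R :=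
  Num.max c (sup [set C s w | s in `[0, t]]).

Definition admissible (W : R -> Omega -> R) (mu sigma cbar b x c : R)
  (C : R -> Omega -> R) : Prop :=
  [/\ adapted (aug_filtration W) C,
      (forall w, cadlag (fun t => C t w)) &
      (forall w t, 0 <= t -> (t%:E <= ruin_time W mu sigma x C w)%E ->
         b * running_max c C t w <= C t w <= cbar)].

Definition payoff (W : R -> Omega -> R) (mu sigma r x : R) (C : R -> Omega -> R) : \bar R :=
  (\int[P]_w
     (\int[lebesgue_measure]_(t in [set t : R | (0 <= t)%R /\ (t%:E <= ruin_time W mu sigma x C w)%E])
        (expR (- (r * t)) * C t w)%R%:E))%E.

Definition value_fun (W : R -> Omega -> R) (mu sigma r cbar b x c : R) : \bar R :=
  ereal_sup [set payoff W mu sigma r x C | C in admissible W mu sigma cbar b x c].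

End dividend_model.

Definition gamma_const {R : realType} (mu sigma cbar r : R) : R :=
  (Num.sqrt ((mu - cbar) ^+ 2 + 2 * sigma ^+ 2 * r) + (mu - cbar)) / sigma ^+ 2.

(* Main.v *)
(**
  Up to ruin an admissible rate C has values in [0, cbar], and it may be clipped to this
  interval afterwards.  Put [g = gamma_const],
  [a = cbar - C], [A t] = the integral of [a] over [0, t], and
  [N t = exp (- r t - g (x + (mu - cbar) t + sigma W t))]: by the choice of [g] this is
  an exponential Brownian martingale, and [Z t = N t * exp (- g * A t)] equals
  [exp (- r t - g X t)] along the surplus X.  As A is absolutely continuous and adapted,
  Fubini alone, without stochastic integrals, shows that
  [Z t + g * integral of Z s * a s over [0, t]] is a martingale.  Stop it at the minimum
  of the ruin time and T.  Up to ruin X is nonnegative, and [cbar * g <= r] is exactly the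
  hypothesis [2 mu cbar <= sigma ^ 2 r]; so [cbar / r] times the stopped value is at most
  [cbar / r * exp (- r theta)] plus the discounted integral of [a].  Hence the expected
  dividends fall short of the perpetuity [cbar / r] by at least [cbar / r * exp (- g x)].
  For [C = cbar] the integral terms vanish, and X being nonpositive at ruin gives the
  reverse inequality.
*)
Require Import Defs.
From HB Require Import structures.
From mathcomp Require Import all_boot all_order all_algebra.
From mathcomp Require Import all_classical all_reals all_analysis.
From mathcomp Require Import measurable_realfun ring lra.
Set Implicit Arguments.
Unset Strict Implicit.
Unset Printing Implicit Defensive.
Import Order.TTheory GRing.Theory Num.Def Num.Theory.
Import numFieldNormedType.Exports.
Local Open Scope classical_set_scope.
Local Open Scope ring_scope.

(** * Integration and independence *)

(** A verification by Ito's formula would need stochastic integrals against the controlled surplus.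
    They are avoided because [Z] is the exponential martingale [N], in which the control does not
    appear, times a discount of finite variation: under the expectation [N s] may be exchanged for
    the later [N T], after which the time integral is pathwise and explicit. Three obstacles shape
    the rest. Admissibility binds the rate only up to ruin, while the martingale needs bounds at all
    times; pointwise clipping restores them and preserves adaptedness and right continuity. The ruin
    time may be infinite, so everything is stopped at a finite horizon [T], at the price of an error
    of at most [cbar / r * exp (- r T)]. The dividends of a path are never shown to be measurable in
    the scenario, so payoffs are compared with measurable bounds through monotonicity of the
    integral of nonnegative functions, and identities between integrals are kept in additive form
    rather than subtracted. *)

Lemma ge0_le_integral_nonmeasurable {d} {T : measurableType d} {R : realType}
    (mu : {measure set T -> \bar R}) (D : set T) (f g : T -> \bar R) :
  (forall x, D x -> (0 <= f x)%E) -> (forall x, D x -> (f x <= g x)%E) ->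
  (\int[mu]_(x in D) f x <= \int[mu]_(x in D) g x)%E.
Proof.
move=> f0 fg; rewrite integral_mkcond [leRHS]integral_mkcond.
have h0 (h : T -> \bar R) : (forall x, D x -> (0 <= h x)%E) ->
    forall x, (0 <= (h \_ D) x)%E.
  move=> hD x; rewrite patchE; case: ifPn => //; rewrite inE; exact: hD.
rewrite !ge0_integralTE; last 2 first.
- by apply: h0 => x Dx; apply: le_trans (fg _ Dx); exact: f0.
- exact: h0.
(* The integral of a nonnegative function is by definition a supremum over the simple functions
   below it, and a candidate for [f] is one for [g]. *)
apply: le_ereal_sup => _ [h /= hf <-]; exists h => //= x.
apply: (le_trans (hf x)); rewrite !patchE; case: ifPn => //.
by rewrite inE; exact: fg.
Qed.

Section sub_sigma_algebra_measurability.
Context {d : measure_display} {Omega : measurableType d} {d' : measure_display}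
  {Y : measurableType d'}.

(* [g_sigma_algebraType G] is [Omega] carrying the smaller sigma-algebra <<s G >>. *)
Lemma sub_measurable_fun (G H : set (set Omega)) (f : Omega -> Y) :
  <<s G >> `<=` <<s H >> ->
  measurable_fun setT (f : g_sigma_algebraType G -> Y) ->
  measurable_fun setT (f : g_sigma_algebraType H -> Y).
Proof. by move=> GH mf _ B mB; apply: GH; exact: mf. Qed.

Lemma sub_measurable_funT (G : set (set Omega)) (f : Omega -> Y) :
  <<s G >> `<=` d.-measurable ->
  measurable_fun setT (f : g_sigma_algebraType G -> Y) -> measurable_fun setT f.
Proof. by move=> GH mf _ B mB; apply: GH; exact: mf. Qed.

End sub_sigma_algebra_measurability.

Section independence.
Context {R : realType} {d : measure_display} {Omega : measurableType d}.
Variable P : probability Omega R.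

(** Independence makes the law of the pair agree with the product of the marginal laws on
    rectangles, hence everywhere, and Tonelli factors the integral. The second factor stays an
    integral over the law of [X], ready for a moment generating function. *)
Lemma indep_expectation (G : set (set Omega)) (X Y : Omega -> R) (f : R -> R) :
  <<s G >> `<=` measurable -> measurable_fun setT X -> indep_of P <<s G >> X ->
  measurable_fun setT (Y : g_sigma_algebraType G -> R) -> (forall w, 0 <= Y w) ->
  measurable_fun setT f -> (forall y, 0 <= f y) ->
  (\int[P]_w (Y w * f (X w))%:E
    = \int[P]_w (Y w)%:E * \int[pushforward P X]_y (f y)%:E)%E.
Proof.
move=> Gm mX indX mY Y0 mf f0.
have mY' : measurable_fun setT Y by exact: sub_measurable_funT mY.
pose phi (w : Omega) : R * R := (Y w, X w).
have mphi : measurable_fun setT phi by exact/measurable_fun_pair.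
pose muY : {finite_measure set R -> \bar R} := 
  distribution P (mfun_Sub (mem_set mY') : {RV P >-> R}).
pose muX : {finite_measure set R -> \bar R} := 
  distribution P (mfun_Sub (mem_set mX) : {RV P >-> R}).
pose muYX : {measure set (R * R) -> \bar R} :=
  distribution P (mfun_Sub (mem_set mphi) : {mfun Omega >-> (R * R)%type}).
have prodE : forall S : set (R * R), measurable S -> (muY \x muX)%E S = muYX S.
  apply: product_measure_unique => A B mA mB.
  rewrite /muYX /muY /muX /= /distribution /pushforward /=.
  have -> : phi @^-1` (A `*` B) = (Y @^-1` A) `&` (X @^-1` B) by [].
  apply: indX => //.
  by rewrite -[_ @^-1` _]setTI; exact: mY.



(* Tonelli needs nonnegativity on the whole plane, whereas only the values of [Y] are known to be
   nonnegative; hence the absolute value. *)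
pose F (p : R * R) : R := `|p.1| * f p.2.
have mF : @measurable_fun _ _ (R * R)%type R setT F.
  by apply: measurable_funM; apply: measurableT_comp.
have mF' : @measurable_fun _ _ (R * R)%type (\bar R) setT (EFin \o F).
  exact/measurable_EFinP.
have F0 p : (0 <= (EFin \o F) p)%E by rewrite lee_fin mulr_ge0.
rewrite [LHS](_ : _ = \int[P]_(w in phi @^-1` setT) ((EFin \o F) \o phi) w)%E;
  last first.
  rewrite preimage_setT.
  by apply: eq_integral => w _ /=; rewrite /F /= ger0_norm.
rewrite -(ge0_integral_pushforward mphi) //.
rewrite -[LHS]/(\int[muYX]_p (EFin \o F) p)%E.
transitivity (\int[(muY \x muX)%E]_p (EFin \o F) p)%E.
  by apply: eq_measure_integral => A mA _; apply: esym; exact: prodE.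
rewrite fubini_tonelli1// /fubini_F /F /=.
under eq_integral => y _.
  under eq_integral do rewrite EFinM.
  rewrite ge0_integralZl_EFin//; last 2 first.
  - by move=> z _; rewrite lee_fin.
  - exact/measurable_EFinP.
  over.
rewrite ge0_integralZr//; last 2 first.
- by apply/measurable_EFinP; exact: normr_measurable.
- by apply: integral_ge0 => z _; rewrite lee_fin.
congr (_ * _)%E.
rewrite [LHS](_ : _ = \int[pushforward P Y]_(y in setT) `|y|%:E)%E//.
rewrite ge0_integral_pushforward//; last first.
  by apply/measurable_EFinP; exact: normr_measurable.
by rewrite preimage_setT; apply: eq_integral => w _ /=; rewrite ger0_norm.
Qed.

(** * Densities and Gaussian moments *)

Import HBNNSimple.

(** The identity holds for simple functions by linearity and passes to [f] by monotone convergence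
    on both sides. *)
Lemma integral_density {d' : measure_display} {T : measurableType d'}
    (mu nu : {measure set T -> \bar R}) (g f : T -> R) :
  measurable_fun setT g -> (forall x, 0 <= g x) ->
  (forall A, measurable A -> nu A = \int[mu]_(x in A) (g x)%:E)%E ->
  measurable_fun setT f -> (forall x, 0 <= f x) ->
  (\int[nu]_x (f x)%:E = \int[mu]_x (f x * g x)%:E)%E.
Proof.
move=> mg g0 nuE mf f0.
have simple (h : {nnsfun T >-> R}) :
    (\int[nu]_x (h x)%:E = \int[mu]_x (h x * g x)%:E)%E.
  under [LHS]eq_integral do rewrite fimfunE -fsumEFin//.
  rewrite [LHS]ge0_integral_fsum//; last 2 first.
  - by move=> r; exact/measurable_EFinP/measurableT_comp.
  - by move=> n x _; rewrite EFinM nnfun_muleindic_ge0.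
  under [RHS]eq_integral.
    move=> x xD; rewrite fimfunE EFinM -fsumEFin// ge0_mule_fsuml; last first.
      by move=> r; rewrite EFinM nnfun_muleindic_ge0.
    over.
  rewrite [RHS]ge0_integral_fsum//; last 2 first.
  - move=> r; apply: emeasurable_funM; last exact/measurable_EFinP.
    exact/measurable_EFinP/measurableT_comp.
  - move=> r x _; apply: mule_ge0; last by rewrite lee_fin.
    by rewrite EFinM nnfun_muleindic_ge0.
  apply: eq_fsbigr => r _.
  rewrite integralZl_indic_nnsfun//= integral_indic//= setIT.
  have mr : measurable (h @^-1` [set r]) by exact: measurable_sfunP.
  rewrite nuE//.
  (* Pulling [r] out of the integral requires [0 <= r]; a negative level of a nonnegative simple
     function is empty, and both sides are 0. *)
  have [r0|r0] := leP 0 r; last first.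
    rewrite (_ : h @^-1` [set r] = set0); last first.
      apply/seteqP; split => x //= hx; suff : 0 <= r by rewrite leNgt r0.
      by rewrite -hx; exact: fun_ge0.
    rewrite integral_set0 mule0 integral0_eq// => x _.
    by rewrite indicE in_set0 mulr0 mul0e.
  rewrite [X in (_ * X)%E]integral_mkcond -ge0_integralZl_EFin//; last 2 first.
  - by move=> x _; rewrite erestrict_ge0// => y _; rewrite lee_fin.
  - apply/(measurable_restrictT _ _).1 => //; apply: measurable_funTS; exact/measurable_EFinP.
  apply: eq_integral => x _; rewrite patchE indicE.
  by case: ifPn => _; rewrite ?mulr1 ?mulr0 ?mul0e ?mule0.
pose f_ := nnsfun_approx measurableT ((measurable_EFinP _ _).2 mf).
transitivity (lim (\int[nu]_x (f_ n x)%:E @[n --> \oo])%E).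
  rewrite -monotone_convergence//=.
  - apply: eq_integral => x /[!inE] xD; apply/esym/cvg_lim => //=.
    by apply: cvg_nnsfun_approx => // y _; rewrite lee_fin.
  - by move=> n; exact/measurable_EFinP/measurable_funTS.
  - by move=> n ? _; rewrite lee_fin.
  - by move=> ? _ ? ? mn; rewrite lee_fin; exact/lefP/nd_nnsfun_approx.
transitivity (lim (\int[mu]_x (f_ n x * g x)%:E @[n --> \oo])%E); last first.
  rewrite -monotone_convergence//=.
  - apply: eq_integral => x /[!inE] xD; apply/cvg_lim => //=.
    under eq_fun do rewrite EFinM.
    rewrite EFinM; apply: cvgeZr => //.
    by apply: cvg_nnsfun_approx => // y _; rewrite lee_fin.
  - move=> n; apply/measurable_EFinP/measurable_funM => //.
  - by move=> n ? _; rewrite lee_fin mulr_ge0.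
  - move=> x _ m n mn; rewrite lee_fin ler_wpM2r//.
    exact/lefP/nd_nnsfun_approx.
by apply: congr_lim; apply/funext => n; exact: simple.
Qed.

(** Completing the square: the exponential weight turns the centred density into a constant times
    the density with mean [lambda * s ^+ 2], which has mass 1. *)
Lemma normal_mgf (lambda s : R) : 0 < s ->
  (\int[normal_prob 0 s]_y (expR (lambda * y))%:E
    = (expR (lambda ^+ 2 * s ^+ 2 / 2))%:E)%E.
Proof.
move=> s0; have sn0 : s != 0 by rewrite gt_eqF.
have mexp : measurable_fun setT (fun y : R => expR (lambda * y)).
  by apply: measurableT_comp => //; exact: measurable_funM.
rewrite (integral_density (mu := lebesgue_measure) (nu := normal_prob 0 s)
  (measurable_normal_pdf 0 s) (normal_pdf_ge0 0 s)
  (fun A _ => erefl) mexp (fun y => expR_ge0 _)).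
transitivity (\int[lebesgue_measure]_y ((expR (lambda ^+ 2 * s ^+ 2 / 2))%:E *
    (normal_pdf (lambda * s ^+ 2) s y)%:E))%E.
  apply: eq_integral => y _; rewrite -EFinM !normal_pdfE//; congr EFin.
  rewrite mulrCA [RHS]mulrCA; congr (_ * _).
  rewrite /normal_fun -!expRD; congr expR.
  by field.
rewrite ge0_integralZl_EFin//; last 2 first.
- by move=> x _; rewrite lee_fin normal_pdf_ge0.
- by apply/measurable_EFinP; exact: measurable_normal_pdf.
by rewrite integral_normal_pdf mule1.
Qed.

(** * Natural and augmented filtrations *)

Lemma natural_sigma_measurable (W : R -> Omega -> R) (t : R) :
  (forall s, 0 <= s -> measurable_fun setT (W s)) ->
  natural_sigma W t `<=` measurable.
Proof.
move=> mW; apply: smallest_sub; first exact: sigma_algebra_measurable.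
move=> A [s [B [/andP[s0 _] mB ->]]]; rewrite -[_ @^-1` _]setTI; exact: mW.
Qed.

Lemma aug_filtration_measurable (W : R -> Omega -> R) (t : R) :
  (forall s, 0 <= s -> measurable_fun setT (W s)) ->
  aug_filtration P W t `<=` measurable.
Proof.
move=> mW; apply: smallest_sub; first exact: sigma_algebra_measurable.
move=> A [nA|[]//]; apply: (natural_sigma_measurable mW (t:=t)).
exact: sub_sigma_algebra.
Qed.

Lemma sub_aug_filtration (W : R -> Omega -> R) (s t : R) :
  s <= t -> aug_filtration P W s `<=` aug_filtration P W t.
Proof.
move=> st; apply: sub_sigma_algebra2; apply: setUSS => // A.
move=> [u [B [/andP[u0 us] mB ->]]]; exists u, B; split => //.
by rewrite u0 (le_trans us).
Qed.

(** Events that coincide off a null set with an event of the natural filtration form a sigma-algebra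
    [Q] containing both kinds of generators. Independence only sees probabilities, so it passes from
    the natural event to the augmented one. *)
Lemma indep_of_aug_filtration (W : R -> Omega -> R) (t : R) (X : Omega -> R) :
  (forall s, 0 <= s -> measurable_fun setT (W s)) -> measurable_fun setT X ->
  indep_of P (natural_sigma W t) X -> indep_of P (aug_filtration P W t) X.
Proof.
move=> mW mX indX.
pose Q (A : set Omega) := exists A' N, [/\ natural_sigma W t A', measurable N,
  P N = 0%E & A `\` N = A' `\` N].
have Qsigma : sigma_algebra setT Q.
  split.
  - exists set0, set0; split => //; exact: sigma_algebra0.
  - move=> A [A' [N [nA' mN N0 AA']]]; exists (~` A'), N; split => //.
      by rewrite -setTD; exact: sigma_algebraCD.
    rewrite setTD; apply/seteqP; split => w /= [nA nN]; split => //.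
      move=> A'w; apply: nA; have [] // : (A `\` N) w by rewrite AA'.
    move=> Aw; apply: nA; have [] // : (A' `\` N) w by rewrite -AA'.
  - move=> A /(_ _)/cid-/all_sig[A'] /(_ _)/cid-/all_sig[N] AN.
    exists (\bigcup_n A' n), (\bigcup_n N n); split.
    + by apply: sigma_algebra_bigcup => n; have [] := AN n.
    + by apply: bigcup_measurable => n _; have [] := AN n.
    + apply/eqP; rewrite -measure_le0.
      have /le_trans : (P (\bigcup_n N n) <= \sum_(n <oo) P (N n))%E.
        apply: measure_sigma_subadditive => //.
        - by move=> n; have [] := AN n.
        - by apply: bigcup_measurable => n _; have [] := AN n.
      by apply; rewrite eseries0// => n _ _; have [] := AN n.
    + apply/seteqP; split => w /= [[n _ Aw] nN]; split => //; exists n => //.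
        have : (A n `\` N n) w by split => // Nw; apply: nN; exists n.
        by have [_ _ _ ->] := AN n; case.
      have : (A' n `\` N n) w by split => // Nw; apply: nN; exists n.
      by have [_ _ _ <-] := AN n; case.
have sub : aug_filtration P W t `<=` Q.
  apply: smallest_sub => // A [nA|[mA A0]].
    by exists A, set0; split => //; exact: sub_sigma_algebra.
  exists set0, A; split => //; first exact: sigma_algebra0.
  by rewrite setDv set0D.
move=> A B FA mB.
have [A' [N [nA' mN N0 AA']]] := sub _ FA.
have mA := aug_filtration_measurable mW FA.
have mA' := natural_sigma_measurable mW nA'.
have mXB : measurable (X @^-1` B) by rewrite -[_ @^-1` _]setTI; exact: mX.
have negl C : measurable C -> P C = P (C `\` N).
  move=> mC; apply/eqP; rewrite eq_le; apply/andP; split; last first.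
    by apply: le_measure => //; rewrite ?inE//; exact: measurableD.
  rewrite -[leRHS]adde0 -N0.
  apply: le_trans (measureU2 _ _ _) => //; last exact: measurableD.
  by apply: le_measure; rewrite ?inE//; [apply: measurableU => //; exact: measurableD |
    move=> w Cw; have [Nw|nNw] := pselect (N w); [right|left]].
rewrite negl; last exact: measurableI.
have setDI (C D : set Omega) : (C `&` D) `\` N = (C `\` N) `&` D.
  by rewrite !setDE setIAC.
rewrite setDI AA' -setDI -negl; last exact: measurableI.
by rewrite indX// (negl _ mA') -AA' -negl.
Qed.

End independence.

(** * Right-continuous processes *)

Section right_continuous_process.
Context {R : realType} {d : measure_display} {S : measurableType d}.
Implicit Types Y : R -> S -> R.

Definition right_continuous_paths Y :=
  forall w t, 0 <= t -> Y s w @[s --> t^'+] --> Y t w.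

(* The value at time s is approximated by the one at the next point of a grid
   of mesh 1 / n.+1. *)
Lemma measurable_fun_process Y :
  (forall t, 0 <= t -> measurable_fun setT (Y t)) -> right_continuous_paths Y ->
  @measurable_fun _ _ (R * S)%type R setT (fun p => Y (Num.max 0 p.1) p.2).
Proof.
move=> mY rcY.
pose k n (s : R) := truncn (n.+1%:R * Num.max 0 s).
pose Yn n (p : R * S) : R := Y ((k n p.1).+1%:R / n.+1%:R) p.2.
apply: (@measurable_fun_cvg _ (R * S)%type R setT Yn).
- move=> n _ B mB; rewrite setTI.
  have -> : Yn n @^-1` B = \bigcup_i
      ((fun s => n.+1%:R * Num.max 0 s) @^-1` `[i%:R, i.+1%:R[%classic `*`
       (Y (i.+1%:R / n.+1%:R) @^-1` B)).
    apply/seteqP; split => [[s w] /= YB|[s w] [i _ [/= + YB]]].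
      exists (k n s) => //; split => //=.
      by rewrite in_itv /= /k truncn_itv// mulr_ge0// le_max lexx.
    rewrite in_itv /= => /truncn_def ki; rewrite /Yn /k /= ki.
    exact: YB.
  apply: bigcup_measurable => i _; apply: measurableX.
    rewrite -[X in measurable X]setTI.
    have mf : measurable_fun setT (fun s : R => n.+1%:R * Num.max 0 s).
      by apply: measurable_funM => //; exact: measurable_maxr.
    exact: mf.
  by rewrite -[X in measurable X]setTI; apply: mY => //; rewrite divr_ge0.
- move=> [s w] _ /=; rewrite /Yn /=.
  set s0 := Num.max 0 s; have s00 : 0 <= s0 by rewrite le_max lexx.
  (* The successor in the grid index puts the sampled time strictly to the right of [s0], as the
     sequential form of a right limit demands. *)
  have /cvg_at_rightP := rcY w s0 s00; apply; split.
    move=> n; rewrite ltr_pdivlMr// mulrC.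
    by have /andP[] := truncn_itv (mulr_ge0 (ler0n R n.+1) s00).
  apply/cvgrPdist_le => e e0.
  near=> n.
  rewrite ler0_norm; last first.
    rewrite subr_le0 ler_pdivlMr// mulrC ltW//.
    by have /andP[] := truncn_itv (mulr_ge0 (ler0n R n.+1) s00).
  rewrite opprB lerBlDr.
  apply: (@le_trans _ _ (n.+1%:R^-1 + s0)); last first.
    rewrite lerD2r -[e]invrK lef_pV2 ?posrE ?invr_gt0//.
    apply: le_trans (_ : n%:R <= _); last by rewrite ler_nat.
    by near: n; exact: nbhs_infty_ger.
  rewrite -natr1 mulrDl mul1r addrC lerD2l ler_pdivrMr// mulrC.
  by have /andP[] := truncn_itv (mulr_ge0 (ler0n R n.+1) s00).
Unshelve. all: by end_near. Qed.

Let maxid (t : R) : 0 <= t -> Num.max 0 t = t.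
Proof. by move=> t0; apply/max_idPr. Qed.

Lemma measurable_path Y w :
  (forall t, 0 <= t -> measurable_fun setT (Y t)) -> right_continuous_paths Y ->
  measurable_fun (`[0, +oo[%classic : set R) (fun s : R => Y s w).
Proof.
move=> mY rcY.
have mf : measurable_fun setT (fun s : R => Y (Num.max 0 s) w).
  have mw : @measurable_fun _ _ R (R * S)%type setT (fun s => (s, w)).
    exact: measurable_fun_pair.
  exact: measurableT_comp (measurable_fun_process mY rcY) mw.
apply: (eq_measurable_fun (fun s : R => Y (Num.max 0 s) w)).
  by move=> s; rewrite inE /= in_itv /= andbT => /maxid ->.
exact: measurable_funTS.
Qed.

Lemma measurable_integral_process Y (D : set R) :
  (forall t, 0 <= t -> measurable_fun setT (Y t)) -> right_continuous_paths Y ->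
  (forall s w, 0 <= s -> 0 <= Y s w) -> measurable D -> D `<=` [set s | 0 <= s] ->
  measurable_fun setT (fun w => \int[lebesgue_measure]_(s in D) (Y s w)%:E)%E.
Proof.
move=> mY rcY Y0 mD D0.
have mf := measurable_fun_process mY rcY.
pose F (p : R * S) : \bar R := (Y (Num.max 0 p.1) p.2 * \1_D p.1)%:E.
have mF : @measurable_fun _ _ (R * S)%type (\bar R) setT F.
  apply/measurable_EFinP/measurable_funM => //.
  exact: measurableT_comp.
have F0 p : (0 <= F p)%E.
  by rewrite lee_fin mulr_ge0 ?indicE//; apply: Y0; rewrite le_max lexx.
have := measurable_fun_fubini_tonelli_G (m1 := lebesgue_measure) F mF F0.
apply: eq_measurable_fun => w _; rewrite /fubini_G [RHS]integral_mkcond.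
apply: eq_integral => s _; rewrite patchE /F indicE /=.
case: ifPn => [|_]; last by rewrite mulr0.
by rewrite inE => /D0 s0; rewrite mulr1 maxid.
Qed.

Lemma right_continuous_stopped Y (t : R) :
  right_continuous_paths Y -> right_continuous_paths (fun s => Y (Num.min s t)).
Proof.
move=> rcY w s s0; have [st|ts] := ltP s t.
  apply: cvg_trans (rcY w s s0).
  apply: near_eq_cvg; near=> u; rewrite min_l//.
  by near: u; exact: nbhs_right_le.
apply: cvg_near_cst; near=> u; rewrite min_r//.
by rewrite (le_trans ts)//; near: u; exact: nbhs_right_ge.
Unshelve. all: by end_near. Qed.

(** Freezing the process at [t] leaves the integral unchanged and involves only times up to [t].
    Over the sigma-algebra of time [t] this says that the running integral is adapted. *)
Lemma measurable_integral_process_upto Y (t : R) :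
  0 <= t -> (forall s, 0 <= s <= t -> measurable_fun setT (Y s)) ->
  right_continuous_paths Y -> (forall s w, 0 <= s -> 0 <= Y s w) ->
  measurable_fun setT (fun w => \int[lebesgue_measure]_(s in `[0%R, t]) (Y s w)%:E)%E.
Proof.
move=> t0 mY rcY Y0.
have : measurable_fun setT
    (fun w => \int[lebesgue_measure]_(s in `[0%R, t]) (Y (Num.min s t) w)%:E)%E.
  apply: (@measurable_integral_process (fun s => Y (Num.min s t))) => //.
  - by move=> s s0; apply: mY; rewrite le_min s0 t0 ge_min lexx orbT.
  - exact: right_continuous_stopped.
  - by move=> s w s0; apply: Y0; rewrite le_min s0.
  - by move=> s; rewrite /= in_itv /= => /andP[].
apply: eq_measurable_fun => w _; apply: eq_integral => s.
by rewrite inE /= in_itv /= => /andP[_ st]; rewrite min_l.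
Qed.

Lemma tonelli_process (mu : {sigma_finite_measure set S -> \bar R}) Y
    (D : set R) (A : set S) :
  (forall t, 0 <= t -> measurable_fun setT (Y t)) -> right_continuous_paths Y ->
  (forall s w, 0 <= s -> 0 <= Y s w) -> measurable D -> D `<=` [set s | 0 <= s] ->
  measurable A ->
  (\int[mu]_(w in A) \int[lebesgue_measure]_(s in D) (Y s w)%:E
   = \int[lebesgue_measure]_(s in D) \int[mu]_(w in A) (Y s w)%:E)%E.
Proof.
move=> mY rcY Y0 mD D0 mA.
have mf := measurable_fun_process mY rcY.
pose F (p : R * S) : \bar R := (Y (Num.max 0 p.1) p.2 * (\1_D p.1 * \1_A p.2))%:E.
have mF : @measurable_fun _ _ (R * S)%type (\bar R) setT F.
  apply/measurable_EFinP/measurable_funM => //.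
  by apply: measurable_funM; apply: measurableT_comp => //.
have F0 p : (0 <= F p)%E.
  by rewrite lee_fin mulr_ge0 ?mulr_ge0// Y0// le_max lexx.
have := fubini_tonelli (m1 := lebesgue_measure) (m2 := mu) F mF F0.
rewrite /fubini_F /fubini_G => FE.
rewrite [LHS]integral_mkcond [RHS]integral_mkcond; apply: etrans (etrans (esym FE) _).
- apply: eq_integral => w _; rewrite patchE; case: ifPn => wA.
    rewrite [LHS]integral_mkcond; apply: eq_integral => s _.
    rewrite patchE /F /= !indicE wA mulr1.
    case: ifPn => [sD|_]; last by rewrite mulr0.
    by rewrite mulr1 maxid//; apply: D0; rewrite inE in sD.
  by rewrite integral0_eq// => s _; rewrite /F /= !indicE (negbTE wA) !mulr0.
- apply: eq_integral => s _; rewrite patchE; case: ifPn => sD.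
    rewrite [RHS]integral_mkcond; apply: eq_integral => w _.
    rewrite patchE /F /= !indicE sD mul1r.
    case: ifPn => [wA|_]; last by rewrite mulr0.
    by rewrite mulr1 maxid//; apply: D0; rewrite inE in sD.
  by rewrite integral0_eq// => w _; rewrite /F /= !indicE (negbTE sD) mul0r mulr0.
Qed.

End right_continuous_process.

(** * Optional stopping *)

Section discrete_stopping.
Context {T : Type} {V : Type}.
Variables (g : nat -> T -> V) (B : nat -> set T).

(** Recursion on the number of remaining indices avoids a stopping index as a separate random
    variable, and lets inductions split on the first event [B j]. *)
Fixpoint stopped (j m : nat) (w : T) : V :=
  if m is m'.+1 then if `[< B j w >] then g j w else stopped j.+1 m' w
  else g j w.

Lemma stoppedP j m w : exists k, [/\ (j <= k <= j + m)%N, stopped j m w = g k w,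
  (k < j + m)%N -> B k w & forall i, (j <= i < k)%N -> ~ B i w].
Proof.
elim: m j => [|m IH] j /=.
  exists j; split => //; rewrite ?addn0 ?leqnn ?ltnn//.
  by move=> i /andP[ji ij]; move: (leq_ltn_trans ji ij); rewrite ltnn.
case: asboolP => [Bj|nBj].
  exists j; split => //; rewrite ?leqnn ?leq_addr//.
  by move=> i /andP[ji ij]; move: (leq_ltn_trans ji ij); rewrite ltnn.
have [k [/andP[jk kjm] -> Bk nB]] := IH j.+1.
exists k; split => //; rewrite -?addSnnS ?kjm ?(ltnW jk)//.
move=> i /andP[]; rewrite leq_eqVlt => /predU1P[<-//|ji ik].
by apply: nB; rewrite ji.
Qed.

End discrete_stopping.

Lemma comp_stopped {T V V' : Type} (f : V -> V') (g : nat -> T -> V) B j m w :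
  stopped (fun k => f \o g k) B j m w = f (stopped g B j m w).
Proof. by elim: m j => [|m IH] j //=; case: ifPn. Qed.

Section optional_stopping.
Context {R : realType} {d : measure_display} {Omega : measurableType d}.
Variable P : probability Omega R.

Lemma measurable_stopped (g : nat -> Omega -> \bar R) (B : nat -> set Omega) j m :
  (forall k, (j <= k <= j + m)%N -> measurable_fun setT (g k)) ->
  (forall k, (j <= k < j + m)%N -> measurable (B k)) ->
  measurable_fun setT (stopped g B j m).
Proof.
elim: m j => [|m IH] j /= mg mB; first by apply: mg; rewrite leqnn leq_addr.
apply: measurable_fun_ifT.
- apply: (measurable_fun_bool true); rewrite setTI.
  rewrite (_ : _ @^-1` _ = B j); first by apply: mB; rewrite leqnn addnS ltnS leq_addr.
  by apply/seteqP; split => w /= /asboolP.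
- by apply: mg; rewrite leqnn leq_addr.
- apply: IH => k /andP[jk kj].
    by apply: mg; rewrite addSnnS in kj; rewrite kj ltnW.
  by apply: mB; rewrite addSnnS in kj; rewrite kj ltnW.
Qed.

(** Split [A] by [B j]: on the event the stopped value is [g j] and [relg] applies; off it the
    remaining set is known at the next index and the induction continues. The relation [rel] is
    equality for martingales and the order for submartingales. *)
Lemma integral_stopped (rel : \bar R -> \bar R -> Prop) (g : nat -> Omega -> \bar R)
    (B : nat -> set Omega) (H : nat -> set (set Omega)) j m A :
  (forall a b a' b', rel a b -> rel a' b' -> rel (a + a')%E (b + b')%E) ->
  (forall k w, (0 <= g k w)%E) ->
  (forall k, (j <= k <= j + m)%N -> measurable_fun setT (g k)) ->
  (forall k, H k `<=` measurable) ->
  (forall k A, H k A -> (k < j + m)%N -> H k (A `&` B k) /\ H k.+1 (A `\` B k)) ->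
  (forall k, (j <= k < j + m)%N -> H k (B k)) ->
  (forall k A, (j <= k <= j + m)%N -> H k A ->
    rel (\int[P]_(w in A) g k w)%E (\int[P]_(w in A) g (j + m)%N w)%E) ->
  H j A ->
  rel (\int[P]_(w in A) stopped g B j m w)%E (\int[P]_(w in A) g (j + m)%N w)%E.
Proof.
move=> relD g0; elim: m j A => [|m IH] j A mg Hm HB HBk relg HA.
  by apply: relg => //; rewrite leqnn leq_addr.
have mB k : (j <= k < j + m.+1)%N -> measurable (B k) by move=> ?; apply/Hm/HBk.
have mBj : measurable (B j) by apply: mB; rewrite leqnn addnS ltnS leq_addr.
have mA := Hm _ _ HA.
have [HAB HAnB] := HB j A HA ltac:(by rewrite addnS ltnS leq_addr).
have split_int f : (forall w, (0 <= f w)%E) -> measurable_fun setT f ->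
    (\int[P]_(w in A) f w = \int[P]_(w in A `&` B j) f w +
      \int[P]_(w in A `\` B j) f w)%E.
  move=> f0 mf; rewrite -ge0_integral_setU//.
  - by rewrite setUIDK.
  - exact: measurableI.
  - exact: measurableD.
  - exact: measurable_funTS.
  - by apply/disj_setPS => w [[_ Bw] [_ nBw]].
have st0 i l w : (0 <= stopped g B i l w)%E.
  by have [k [_ -> _ _]] := stoppedP g B i l w.
rewrite split_int//; last exact: measurable_stopped.
rewrite (split_int (g (j + m.+1)%N))//; last by apply: mg; rewrite leqnn leq_addr.
apply: relD.
  rewrite (_ : integral _ _ _ = \int[P]_(w in A `&` B j) g j w)%E.
    by apply: relg => //; rewrite leqnn leq_addr.
  by apply: eq_integral => w; rewrite inE => -[_ Bw] /=; rewrite asboolT.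
rewrite (_ : integral _ _ _ = \int[P]_(w in A `\` B j) stopped g B j.+1 m w)%E; last first.
  by apply: eq_integral => w; rewrite inE => -[_ Bw] /=; rewrite asboolF.
rewrite -addSnnS; apply: IH => //.
- by move=> k /andP[jk kj]; apply: mg; rewrite -addSnnS kj ltnW.
- by move=> k A' HA' kj; apply: HB => //; rewrite -addSnnS.
- by move=> k /andP[jk kj]; apply: HBk; rewrite -addSnnS kj ltnW.
- by move=> k A' /andP[jk kj] HA'; rewrite addSnnS; apply: relg => //; rewrite -addSnnS kj ltnW.
Qed.

Variables (Gen : R -> set (set Omega)) (T : R) (G : R -> Omega -> R) (theta : Omega -> R).
Hypothesis T_gt0 : 0 < T.
Hypothesis Gen_sub : forall t, <<s Gen t >> `<=` measurable.
Hypothesis Gen_mono : forall s t, s <= t -> <<s Gen s >> `<=` <<s Gen t >>.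
Hypothesis G_adapted : forall t, 0 <= t <= T ->
  measurable_fun setT (G t : g_sigma_algebraType (Gen t) -> R).
Hypothesis G_ge0 : forall t w, 0 <= G t w.
Hypothesis G_rc : right_continuous_paths G.
Hypothesis G_fin : (\int[P]_w (G T w)%:E < +oo)%E.
Hypothesis G_martingale : forall t A, 0 <= t <= T -> <<s Gen t >> A ->
  (\int[P]_(w in A) (G t w)%:E = \int[P]_(w in A) (G T w)%:E)%E.
Hypothesis theta_itv : forall w, 0 <= theta w <= T.
Hypothesis theta_stopping : forall t, 0 <= t -> <<s Gen t >> [set w | theta w <= t].

Let excess (L : R) (y : R) : R := Num.max (y - L) 0.

Let excess_ge0 L y : 0 <= excess L y.
Proof. by rewrite /excess le_max lexx orbT. Qed.

Let measurable_G t : 0 <= t <= T -> measurable_fun setT (G t).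
Proof. by move=> tT; apply: (sub_measurable_funT (@Gen_sub t)); exact: G_adapted. Qed.

Let measurable_excess L t : 0 <= t <= T ->
  measurable_fun setT (fun w => excess L (G t w)).
Proof.
move=> tT; apply: measurable_maxr => //.
by apply: measurable_funB => //; exact: measurable_G.
Qed.

Let TT : 0 <= T <= T. Proof. by rewrite lexx ltW. Qed.

(** On [B], where [G t] exceeds [L], the excess is [G t - L]; the martingale property replaces it by
    [G T - L], which the excess of [G T] dominates. Off [B] the excess at time [t] vanishes. *)
Let excess_submartingale L t A : 0 <= L -> 0 <= t <= T -> <<s Gen t >> A ->
  (\int[P]_(w in A) (excess L (G t w))%:E <= \int[P]_(w in A) (excess L (G T w))%:E)%E.
Proof.
move=> L0 tT FA.
pose B := A `&` [set w | L < G t w].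
have FB : <<s Gen t >> B.
  apply: (@measurableI _ (g_sigma_algebraType (Gen t))) => //.
  rewrite (_ : [set w | _] = G t @^-1` `]L, +oo[%classic); last first.
    by apply/seteqP; split => w /=; rewrite in_itv /= andbT.
  by rewrite -[_ @^-1` _]setTI; exact: G_adapted.
have mA := Gen_sub FA; have mB := Gen_sub FB.
have BA : B `<=` A by exact: subIsetl.
rewrite (_ : integral _ _ _ = \int[P]_(w in B) (excess L (G t w))%:E)%E; last first.
  rewrite [LHS]integral_mkcond [RHS]integral_mkcond; apply: eq_integral => w _.
  rewrite !patchE; case: ifPn => wA; case: ifPn => wB//.
    rewrite /excess max_r// subr_le0 leNgt; apply/negP => LG.
    by move/negP : wB; apply; rewrite inE; split => //; rewrite inE in wA.
  by move: wB wA; rewrite inE => /BA; rewrite -inE => ->.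
apply: (@le_trans _ _ (\int[P]_(w in B) (excess L (G T w))%:E)%E); last first.
  apply: ge0_subset_integral => //.
  - by apply/measurable_EFinP/measurable_funTS; exact: measurable_excess.
  - by move=> w _; rewrite lee_fin.
(* Adding the finite quantity [L * P B] to both sides removes the subtraction, so only integrals of
   nonnegative functions occur. *)
have PBL : (L%:E * P B)%E \is a fin_num by rewrite fin_numM// fin_num_measure.
rewrite -(leeD2rE _ _ PBL) -integral_cst//.
have splitE (f : Omega -> R) : measurable_fun setT f -> (forall w, 0 <= f w) ->
    (\int[P]_(w in B) (f w)%:E + \int[P]_(w in B) cst L%:E w
     = \int[P]_(w in B) (f w + L)%:E)%E.
  move=> mf f0; rewrite -ge0_integralD//.
  - by move=> w _; rewrite lee_fin.
  - by apply/measurable_EFinP; exact: measurable_funTS.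
rewrite (splitE _ (measurable_excess L tT))// (splitE _ (measurable_excess L TT))//.
rewrite (_ : integral _ _ _ = \int[P]_(w in B) (G t w)%:E)%E; last first.
  apply: eq_integral => w; rewrite inE => -[_ /= LG].
  by rewrite /excess max_l ?subrK// subr_ge0 ltW.
rewrite G_martingale//; apply: ge0_le_integral => //.
- by move=> w _; rewrite lee_fin.
- by apply/measurable_EFinP; apply: measurable_funTS; exact: measurable_G.
- apply/measurable_EFinP; apply: measurable_funTS.
  by apply: measurable_funD => //; exact: measurable_excess.
- by move=> w _; rewrite lee_fin -lerBlDr /excess le_max lexx.
Qed.

Let grid n (k : nat) : R := k%:R * (T / n.+1%:R).
(** The approximation of [theta] by grid times is from the right: the decision to stop is then known
    at the grid time itself, and right continuity of [G] identifies the limit. *)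
Let Sn n : Omega -> R :=
  stopped (fun k => G (grid n k)) (fun k => [set w | theta w <= grid n k]) 0 n.+1.

Let grid_itv n k : (k <= n.+1)%N -> 0 <= grid n k <= T.
Proof.
move=> kn; rewrite /grid mulr_ge0 ?divr_ge0 ?(ltW T_gt0)//=.
rewrite mulrCA ger_pMr// ler_pdivrMr// mul1r ler_nat//.
Qed.

Let grid_last n : grid n n.+1 = T.
Proof. by rewrite /grid mulrCA divff ?mulr1. Qed.

Let SnP n w : exists t, [/\ 0 <= t <= T, Sn n w = G t w & theta w <= t <= theta w + T / n.+1%:R].
Proof.
have [k [/andP[_ kn] SE Bk nB]] := stoppedP (fun k => G (grid n k))
  (fun k => [set w | theta w <= grid n k]) 0 n.+1 w.
rewrite add0n in kn Bk.
exists (grid n k); split => //; first exact: grid_itv.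
apply/andP; split.
  move: kn; rewrite leq_eqVlt => /predU1P[->|/Bk//].
  by rewrite grid_last; case/andP: (theta_itv w).
case: k kn {SE Bk} nB => [_ _|k kn nB].
  by rewrite /grid mul0r addr_ge0 ?divr_ge0// ?(ltW T_gt0)//; case/andP: (theta_itv w).
have /negP := nB k (ltnSn k); rewrite -ltNge => /ltW kt.
by rewrite /grid -natr1 mulrDl mul1r lerD2r.
Qed.

Let measurable_grid_event n k : <<s Gen (grid n k) >> [set w | theta w <= grid n k].
Proof.
by apply: theta_stopping; rewrite mulr_ge0// divr_ge0// ltW.
Qed.

Let integral_Sn (rel : \bar R -> \bar R -> Prop) (f : R -> \bar R) n :
  (forall a b a' b', rel a b -> rel a' b' -> rel (a + a')%E (b + b')%E) ->
  (forall y, 0 <= f y)%E ->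
  (forall t, 0 <= t <= T -> measurable_fun setT (f \o G t)) ->
  (forall t A, 0 <= t <= T -> <<s Gen t >> A ->
    rel (\int[P]_(w in A) f (G t w))%E (\int[P]_(w in A) f (G T w))%E) ->
  rel (\int[P]_w f (Sn n w))%E (\int[P]_w f (G T w))%E.
Proof.
move=> relD f0 mf relf.
have grid_mono k : grid n k <= grid n k.+1.
  by rewrite /grid ler_wpM2r ?ler_nat// divr_ge0// ltW.
have := @integral_stopped rel (fun k => f \o G (grid n k))
  (fun k => [set w | theta w <= grid n k]) (fun k => <<s Gen (grid n k) >>) 0 n.+1 setT
  relD _ _ _ _ _ _ _.
rewrite add0n grid_last (_ : stopped _ _ _ _ = f \o Sn n); last first.
  by apply/funext => w; rewrite comp_stopped.
apply => //.
- by move=> k w; exact: f0.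
- by move=> k kn; apply: mf; exact: grid_itv.
- move=> k A FA _; split.
    apply: (@measurableI _ (g_sigma_algebraType (Gen (grid n k)))) => //.
    exact: measurable_grid_event.
  apply: (Gen_mono (grid_mono k)).
  apply: (@measurableD _ (g_sigma_algebraType (Gen (grid n k)))) => //.
  exact: measurable_grid_event.
- by move=> k A kn FA /=; apply: relf => //; exact: grid_itv.
- exact: (@measurableT _ (g_sigma_algebraType (Gen (grid n 0)))).
Qed.

Let measurable_Sn n : measurable_fun setT (Sn n).
Proof.
apply/measurable_EFinP.
rewrite (_ : _ \o _ = stopped (fun k => EFin \o G (grid n k))
    (fun k => [set w | theta w <= grid n k]) 0 n.+1).
  apply: measurable_stopped => k kn; last first.
    by apply: (@Gen_sub (grid n k)); exact: measurable_grid_event.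
  by apply/measurable_EFinP/measurable_G/grid_itv.
by apply/funext => w; rewrite (comp_stopped EFin).
Qed.

Let cvg_Sn w : Sn n w @[n --> \oo] --> G (theta w) w.
Proof.
have /andP[th0 thT] := theta_itv w.
apply/cvgrPdist_le => e e0.
have /cvgrPdist_le/(_ _ e0) := @G_rc w _ th0.
rewrite near_withinE => /nbhs_ballP[dl /= dl0 Hdl].
near=> n; have [t [_ -> /andP[tht tth]]] := SnP n w.
move: tht; rewrite le_eqVlt => /predU1P[->|tht]; first by rewrite subrr normr0 ltW.
apply: Hdl => //=; rewrite /ball /= ltr0_norm ?subr_lt0// opprB ltrBlDl.
apply: le_lt_trans tth _; rewrite ltrD2l ltr_pdivrMr// mulrC -ltr_pdivrMr//.
apply: (@lt_le_trans _ _ n%:R); last by rewrite ler_nat.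
by near: n; exact: nbhs_infty_gtr.
Unshelve. all: by end_near. Qed.

Lemma measurable_optional_stopping : measurable_fun setT (fun w => G (theta w) w).
Proof. by apply: measurable_fun_cvg measurable_Sn _ => w _; exact: cvg_Sn. Qed.

Let Sn_ge0 n w : 0 <= Sn n w.
Proof. by have [t [_ -> _]] := SnP n w. Qed.

Let integral_Sn_eq n : (\int[P]_w (Sn n w)%:E = \int[P]_w (G T w)%:E)%E.
Proof.
have absE (X : Omega -> R) A : (forall w, 0 <= X w) ->
    (\int[P]_(w in A) `|X w|%:E = \int[P]_(w in A) (X w)%:E)%E.
  by move=> X0; apply: eq_integral => w _; rewrite ger0_norm.
rewrite -absE// -[RHS]absE//.
(* [integral_Sn] asks for a function nonnegative on all reals; the absolute value agrees with the
   identity on the values of [G]. *)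
apply: (@integral_Sn eq (fun y => `|y|%:E)) => [a b a' b' -> ->//|y|t tT|t A tT FA].
- by rewrite lee_fin.
- by apply/measurable_EFinP/measurableT_comp => //; exact: measurable_G.
- by rewrite !absE// G_martingale.
Qed.

Let integral_excess_Sn L n : 0 <= L ->
  (\int[P]_w (excess L (Sn n w))%:E <= \int[P]_w (excess L (G T w))%:E)%E.
Proof.
move=> L0; apply: (@integral_Sn (fun a b => (a <= b)%E) (fun y => (excess L y)%:E)).
- by move=> *; exact: leeD.
- by move=> y; rewrite lee_fin.
- by move=> t tT; apply/measurable_EFinP; exact: measurable_excess.
- by move=> t A tT FA; exact: excess_submartingale.
Qed.

(* The excess over L is a submartingale, so the excess of every grid approximation of
   the stopped value has expectation at most that of [G T], uniformly in the mesh. *)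
Theorem optional_stopping : (\int[P]_w (G (theta w) w)%:E = \int[P]_w (G T w)%:E)%E.
Proof.
have mS := measurable_optional_stopping.
apply/eqP; rewrite eq_le; apply/andP; split.
  (* Fatou along the grid gives the upper bound. The lower bound must exclude a loss of mass in the
     limit, which is where the excess enters. *)
  have := @fatou _ _ _ P setT measurableT (fun n w => (Sn n w)%:E) _ _.
  rewrite [X in (_ <= limn_einf X)%E](_ : _ = fun=> \int[P]_w (G T w)%:E)%E; last first.
    by apply/funext => n; exact: integral_Sn_eq.
  rewrite (cvg_limn_einf_sup (cvg_cst _)).1 => H; apply: le_trans (H _ _).
  - apply: ge0_le_integral_nonmeasurable; first by move=> w _; rewrite lee_fin.
    move=> w _; have SE : (Sn n w)%:E @[n --> \oo] --> (G (theta w) w)%:E.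
      by apply: cvg_EFin; [exact: nearW | exact: cvg_Sn].
    by rewrite (cvg_limn_einf_sup SE).1.
  - by move=> n; apply/measurable_EFinP.
  - by move=> n w _; rewrite lee_fin; have [t [_ -> _]] := SnP n w.
apply/lee_addgt0Pr => e e0.
have iGT : P.-integrable setT (EFin \o G T).
  apply/integrableP; split; first by apply/measurable_EFinP; exact: measurable_G.
  by rewrite (eq_integral (EFin \o G T))// => w _ /=; rewrite ger0_norm.
(* Uniform integrability is reduced to the single variable [G T], whose excesses over [n] are
   dominated by [G T] and tend to 0. *)
have [L L0 HL] : exists2 L : R, 0 <= L & (\int[P]_w (excess L (G T w))%:E <= e%:E)%E.
  have /fine_cvgP[Hfin /cvgrPdist_le/(_ _ e0)Hcvg] :
      (\int[P]_w (excess n%:R (G T w))%:E)%E @[n --> \oo] --> 0%E.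
    rewrite -(integral0 P setT).
    have [] // := @dominated_convergence _ _ _ P setT measurableT
      (fun n w => (excess n%:R (G T w))%:E) (cst 0%E) (EFin \o G T).
    - by move=> n; apply/measurable_EFinP; exact: measurable_excess.
    - apply: aeW => w _; apply: cvg_near_cst; near=> n.
      rewrite /excess max_r// subr_le0.
      by near: n; exact: nbhs_infty_ger.
    - apply: aeW => w n _; rewrite /= lee_fin ger0_norm// /excess ge_max.
      by rewrite G_ge0 andbT lerBlDr lerDl.
  have [n [nfin nle]] := filter_ex (filterI Hfin Hcvg).
  exists n%:R => //; rewrite -[leLHS]fineK// lee_fin.
  by move: nle; rewrite sub0r normrN => /(le_trans (ler_norm _)).
(* After truncation at [L] the grid values are bounded and dominated convergence applies; the part
   cut off is the excess, already below [e]. *)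
pose m (w : Omega) : R := Num.min (G (theta w) w) L.
have int_min : (\int[P]_w (Num.min (Sn n w) L)%:E)%E @[n --> \oo]
    --> (\int[P]_w (m w)%:E)%E.
  have [] // := @dominated_convergence _ _ _ P setT measurableT
    (fun n w => (Num.min (Sn n w) L)%:E) (fun w => (m w)%:E) (EFin \o cst L).
  - by move=> n; apply/measurable_EFinP/measurable_minr.
  - by apply/measurable_EFinP/measurable_minr.
  - apply: aeW => w _; apply: cvg_EFin; first exact: nearW.
    apply/cvgrPdist_le => e' e'0.
    have /cvgrPdist_le/(_ _ e'0) := @cvg_Sn w; apply: filterS => n /=.
    apply: le_trans; rewrite /m; case: (leP (G _ w) L); case: (leP (Sn n w) L) => h1 h2.
    + by [].
    + by rewrite !ler0_norm; lra.
    + by rewrite !ger0_norm; lra.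
    + by rewrite subrr normr0.
  - exact: finite_measure_integrable_cst.
  - apply: aeW => w n _; rewrite /= lee_fin ger0_norm; first by rewrite ge_min lexx orbT.
    by rewrite le_min Sn_ge0.
have : (\int[P]_w (G T w)%:E <= \int[P]_w (m w)%:E + e%:E)%E.
  have min_e := cvgeD (@fin_num_adde_defl R _ e%:E isT) int_min (cvg_cst e%:E).
  apply: (cvge_to_ge (min_e _ _)).
  apply: nearW => n; rewrite -(integral_Sn_eq n).
  apply: (@le_trans _ _ (\int[P]_w (Num.min (Sn n w) L)%:E +
      \int[P]_w (excess L (Sn n w))%:E)%E); last first.
    by rewrite leeD2l// (le_trans _ HL)// integral_excess_Sn.
  rewrite -ge0_integralD//; last 4 first.
  - by move=> w _; rewrite lee_fin le_min Sn_ge0.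
  - by apply/measurable_EFinP/measurable_minr.
  - by move=> w _; rewrite lee_fin.
  - by apply/measurable_EFinP/measurable_maxr => //; exact: measurable_funB.
  apply: ge0_le_integral_nonmeasurable => w _; first by rewrite lee_fin.
  rewrite -EFinD lee_fin /excess; case: (leP (Sn n w) L) => h.
    by rewrite lerDl le_max lexx orbT.
  by rewrite max_l; lra.
move=> /le_trans; apply; rewrite leeD2r//.
apply: ge0_le_integral_nonmeasurable => w _; rewrite lee_fin ?ge_min ?lexx//.
by rewrite le_min G_ge0.
Unshelve. all: by end_near. Qed.

End optional_stopping.

(** * Discounting along a path *)

Section path_calculus.
Context {R : realType}.
Notation mu := (@lebesgue_measure R).
Implicit Types (f h : R -> R) (c k s t u : R).

Definition primitive f t : R := \int[mu]_(s in `[0, t]) f s.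

Definition bounded_rate c f :=
  measurable_fun (`[0, +oo[%classic : set R) f /\ forall s, 0 <= s -> 0 <= f s <= c.

(** Cutting [[0, t]] into [n] equal steps bounds the total increment by [k * t ^+ 2 / n]. This
    replaces a vanishing derivative, since the primitive of a merely measurable rate need not be
    differentiable everywhere. *)
Lemma quadratic_increment_constant h k :
  (forall t u, 0 <= t -> t <= u -> `|h u - h t| <= k * (u - t) ^+ 2) ->
  forall t, 0 <= t -> h t = h 0.
Proof.
move=> hk t t0; apply/eqP; rewrite -subr_eq0 -normr_le0.
have step (dl : R) (i : nat) : 0 <= dl -> `|h (i%:R * dl) - h 0| <= i%:R * (k * dl ^+ 2).
  move=> dl0; elim: i => [|i IH]; first by rewrite !mul0r subrr normr0.
  have -> : h (i.+1%:R * dl) - h 0 =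
    (h (i.+1%:R * dl) - h (i%:R * dl)) + (h (i%:R * dl) - h 0) by ring.
  apply: (le_trans (ler_normD _ _)); rewrite -natr1 [leRHS]mulrDl mul1r addrC lerD//.
  have := hk (i%:R * dl) ((i%:R + 1) * dl); rewrite mulrDl mul1r addrAC subrr add0r.
  by apply; rewrite ?mulr_ge0// lerDl.
apply/ler_addgt0Pr => e e0; rewrite add0r.
have [n nE] : exists n : nat, `|k| * t ^+ 2 / e < n.+1%:R.
  exists (truncn (`|k| * t ^+ 2 / e)).
  have /truncn_itv/andP[_] // : 0 <= `|k| * t ^+ 2 / e.
  by rewrite divr_ge0 ?mulr_ge0 ?sqr_ge0// ltW.
have := step (t / n.+1%:R) n.+1; rewrite mulrCA divff ?mulr1 ?pnatr_eq0// => /(_ _).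
move=> /(_ (divr_ge0 t0 (ler0n _ _))) /le_trans; apply.
have -> : n.+1%:R * (k * (t / n.+1%:R) ^+ 2) = k * t ^+ 2 / n.+1%:R.
  have : n.+1%:R != 0 :> R by rewrite pnatr_eq0.
  by move: n.+1%:R => N N0; field.
rewrite ler_pdivrMr//; apply: le_trans (_ : `|k| * t ^+ 2 <= _).
  by rewrite ler_wpM2r ?sqr_ge0// ler_norm.
by rewrite -ler_pdivrMl// mulrC ltW.
Qed.

Lemma bounded_rate_integrable c f (i : interval R) :
  bounded_rate c f -> [set` i] `<=` [set s | 0 <= s] -> (mu [set` i] < +oo)%E ->
  mu.-integrable [set` i] (EFin \o f).
Proof.
move=> [mf fc] i0 ioo; apply: measurable_bounded_integrable => //.
- apply: measurable_funS mf => //.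
  by move=> s /i0 /= s0; rewrite in_itv /= s0.
- exists c; split; first exact: num_real.
  move=> M cM s /i0 /fc /andP[f0 fle]; rewrite /= ger0_norm//.
  by rewrite (le_trans fle)// ltW.
Qed.

Lemma primitive_increment c f t u : bounded_rate c f -> 0 <= t -> t <= u ->
  primitive f u - primitive f t = \int[mu]_(s in `]t, u]) f s.
Proof.
move=> fc t0 tu; rewrite /primitive Rintegral_itvB//.
- apply: bounded_rate_integrable fc _ _.
    by move=> s /=; rewrite in_itv /= => /andP[].
  by rewrite lebesgue_measure_itv /=; case: ifP => // _; rewrite -EFinD ltry.
Qed.

Lemma primitive_increment_itv c f t u : bounded_rate c f -> 0 <= t -> t <= u ->
  0 <= primitive f u - primitive f t <= c * (u - t).
Proof.
move=> fc t0 tu; rewrite (primitive_increment fc)//.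
have t_pos s : (`]t, u]%classic : set R) s -> 0 <= s.
  by rewrite /= in_itv /= => /andP[/ltW ts _]; exact: le_trans ts.
have muE : mu (`]t, u]%classic : set R) = (u - t)%:E.
  rewrite lebesgue_measure_itv /= lte_fin; case: ltP => [//|ut].
  by rewrite (@le_anti _ _ t u) ?subrr// tu.
have muoo : (mu (`]t, u]%classic : set R) < +oo)%E by rewrite muE ltry.
have fint := bounded_rate_integrable fc t_pos muoo.
apply/andP; split.
  by apply: Rintegral_ge0 => s /t_pos s0; case/andP: (fc.2 s s0).
apply: (@le_trans _ _ (\int[mu]_(s in `]t, u]) cst c s)).
  apply: le_Rintegral => //.
    apply: measurable_bounded_integrable => //; exact: bounded_cst.
  by move=> s /t_pos s0; case/andP: (fc.2 s s0).
by rewrite Rintegral_cst//= muE.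
Qed.

Lemma EFin_primitive c f t : bounded_rate c f -> 0 <= t ->
  (primitive f t)%:E = (\int[mu]_(s in `[0%R, t]) (f s)%:E)%E.
Proof.
move=> fc t0; rewrite /primitive /Rintegral fineK//; apply: integrable_fin_num => //.
apply: bounded_rate_integrable fc _ _.
  by move=> s; rewrite /= in_itv /= => /andP[].
by rewrite lebesgue_measure_itv /=; case: ifP => // _; rewrite -EFinD ltry.
Qed.

Lemma primitive0 f : primitive f 0 = 0.
Proof. by rewrite /primitive set_itv1 Rintegral_set1. Qed.

Lemma primitive_ge0 c f t : bounded_rate c f -> 0 <= t -> 0 <= primitive f t.
Proof.
by move=> fc t0; have /andP[] := primitive_increment_itv fc (lexx 0) t0; rewrite primitive0 subr0.
Qed.

Lemma primitive_continuous c f t : bounded_rate c f -> 0 <= t ->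
  forall e, 0 < e -> exists2 dl : R, 0 < dl &
    forall s, 0 <= s -> `|s - t| < dl -> `|primitive f s - primitive f t| < e.
Proof.
(* The primitive is Lipschitz with constant the absolute value of [c]; adding 1 keeps the
   denominator positive. *)
move=> fc t0 e e0; exists (e / (`|c| + 1)); first by rewrite divr_gt0.
move=> s s0 st.
have lip a b : 0 <= a -> a <= b -> `|primitive f b - primitive f a| <= `|c| * (b - a).
  move=> a0 ab; have /andP[h1 h2] := primitive_increment_itv fc a0 ab.
  by rewrite ger0_norm// (le_trans h2)// ler_wpM2r ?subr_ge0// ler_norm.
have : `|primitive f s - primitive f t| <= `|c| * `|s - t|.
  have [ts|/ltW st'] := leP t s; first by rewrite [`|s - t|]ger0_norm ?subr_ge0// lip.
  by rewrite distrC [`|s - t|]distrC [`|t - s|]ger0_norm ?subr_ge0// lip.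
move=> /le_lt_trans; apply.
apply: (@le_lt_trans _ _ ((`|c| + 1) * `|s - t|)); first by rewrite ler_wpM2r ?lerDl.
by rewrite mulrC -ltr_pdivlMr.
Qed.

Lemma bounded_rate_discount c f g : bounded_rate c f -> 0 <= g ->
  bounded_rate c (fun s => expR (- (g * primitive f s)) * f s).
Proof.
move=> fc g0; split; last first.
  move=> s s0; have /andP[f0 fle] := fc.2 s s0.
  rewrite mulr_ge0 ?expR_ge0//= (le_trans _ fle)// ler_piMl//.
  by rewrite -[leRHS]expR0 ler_expR oppr_le0 mulr_ge0// (primitive_ge0 fc).
apply: measurable_funM; last exact: fc.1.
(* Extended by a constant to negative times, the primitive is continuous on the whole line and
   therefore measurable. *)
have cp : continuous (fun s => primitive f (Num.max 0 s)).
  move=> s; apply/cvgrPdist_lt => e e0.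
  have s0 : 0 <= Num.max 0 s by rewrite le_max lexx.
  have [dl dl0 H] := primitive_continuous fc s0 e0.
  near=> u; rewrite distrC; apply: H; first by rewrite le_max lexx.
  have us : `|u - s| < dl by rewrite distrC; near: u; exact: cvgr_dist_lt.
  apply: le_lt_trans us; rewrite !maxEle.
  case: (leP 0 u) => hu; case: (leP 0 s) => hs; rewrite ?subrr ?normr0//.
  - by rewrite subr0 (ger0_norm hu) [leRHS]ger0_norm; lra.
  - by rewrite sub0r normrN (ger0_norm hs) [leRHS]ler0_norm; lra.
apply: (eq_measurable_fun (fun s => expR (- (g * primitive f (Num.max 0 s))))).
  by move=> s; rewrite inE /= in_itv /= andbT => s0; rewrite max_r.
apply: measurable_funTS; apply: measurableT_comp => //; apply: measurableT_comp => //.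
by apply: measurable_funM => //; exact: continuous_measurable_fun.
Unshelve. all: by end_near. Qed.

(* Both sides lie between [D u * x] and [D t * x] for
   [x = g * (primitive f u - primitive f t)], so they differ by O((u - t)^2). *)
Lemma discount_increment c f g t u : bounded_rate c f -> 0 <= g ->
  0 <= t -> t <= u ->
  let D s := expR (- (g * primitive f s)) in
  g * (\int[mu]_(s in `]t, u]) (D s * f s)) = D t - D u.
Proof.
move=> fc g0 t0 tu D.
have Dfc : bounded_rate c (fun s => D s * f s) := bounded_rate_discount fc g0.
have u0 := le_trans t0 tu.
have D1 s : 0 <= s -> D s <= 1.
  by move=> s0; rewrite -[leRHS]expR0 ler_expR oppr_le0 mulr_ge0// (primitive_ge0 fc).
have Dmono a b : 0 <= a -> a <= b -> D b <= D a.
  move=> a0 ab; rewrite ler_expR lerN2 ler_wpM2l//.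
  by have /andP[] := primitive_increment_itv fc a0 ab; rewrite subr_ge0.
rewrite -(primitive_increment Dfc)//.
suff H s : 0 <= s -> D s + g * primitive (fun s => D s * f s) s =
    D 0 + g * primitive (fun s => D s * f s) 0.
  have := H _ t0; rewrite -(H _ u0) mulrBr; lra.
(* The constant comes from [x <= g * c * (b - a)]: the gap between the two bounds is at most
   [x ^+ 2]. *)
move: s; apply: (@quadratic_increment_constant _ ((g * c) ^+ 2)) => a b a0 ab.
have ba0 : 0 <= b - a by rewrite subr_ge0.
have /andP[p0 pc] := primitive_increment_itv fc a0 ab.
have [x xd] : {x | x = g * (primitive f b - primitive f a)} by eexists.
have x0 : 0 <= x by rewrite xd mulr_ge0.
have xc : x <= g * c * (b - a) by rewrite xd -mulrA ler_wpM2l.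
have a_pos s : (`]a, b]%classic : set R) s -> 0 <= s.
  by rewrite /= in_itv /= => /andP[/ltW as_ _]; exact: le_trans as_.
have muy : (mu (`]a, b]%classic : set R) < +oo)%E.
  by rewrite lebesgue_measure_itv /=; case: ifP => // _; rewrite -EFinD ltry.
have fint := bounded_rate_integrable fc a_pos muy.
have Dfint := bounded_rate_integrable Dfc a_pos muy.
have kfint (k : R) : mu.-integrable `]a, b] (EFin \o (fun s => k * f s)).
  rewrite (_ : _ \o _ = fun s => (k%:E * (f s)%:E)%E)//; exact: integrableZl.
have Px : g * (primitive (fun s => D s * f s) b - primitive (fun s => D s * f s) a)
    = g * \int[mu]_(s in `]a, b]) (D s * f s) by rewrite (primitive_increment Dfc).
have xE (k : R) : k * x = g * \int[mu]_(s in `]a, b]) (k * f s).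
  by rewrite RintegralZl// -(primitive_increment fc)// xd mulrCA.
have Dab : D b = D a * expR (- x) by rewrite -expRD xd; congr expR; ring.
have Dba : D a = D b * expR x by rewrite -expRD xd; congr expR; ring.
have Da1 := D1 a a0; have Db0 : 0 <= D b := expR_ge0 _; have Da0 : 0 <= D a := expR_ge0 _.
have D_bounds s : (`]a, b]%classic : set R) s -> D b <= D s <= D a.
  move=> sab; have s0 := a_pos s sab.
  by move: sab; rewrite /= in_itv /= => /andP[/ltW as_ sb]; rewrite !Dmono.
clearbody D.
have lo : D b * x <= g * \int[mu]_(s in `]a, b]) (D s * f s).
  apply: (eq_ind_r (fun z => z <= _) _ (xE (D b))); apply: ler_wpM2l g0 _ _ _.
  apply: le_Rintegral; [by []|exact: kfint|exact: Dfint|move=> s sab].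
  have /andP[f0 _] := fc.2 s (a_pos s sab); apply: ler_wpM2r f0 _ _ _.
  by case/andP: (D_bounds s sab).
have hi : g * \int[mu]_(s in `]a, b]) (D s * f s) <= D a * x.
  apply: (eq_ind_r (fun z => _ <= z) _ (xE (D a))); apply: ler_wpM2l g0 _ _ _.
  apply: le_Rintegral; [by []|exact: Dfint|exact: kfint|move=> s sab].
  have /andP[f0 _] := fc.2 s (a_pos s sab); apply: ler_wpM2r f0 _ _ _.
  by case/andP: (D_bounds s sab).
(* This bound and the next are [1 + y <= expR y], at [y = x] and at [y = - x]. *)
have lo' : D b * x <= D a - D b.
  have -> : D a - D b = D b * (expR x - 1) by rewrite Dba mulrBr mulr1.
  by rewrite ler_wpM2l//; have := expR_ge1Dx x; lra.
have hi' : D a - D b <= D a * x.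
  have -> : D a - D b = D a * (1 - expR (- x)) by rewrite Dab mulrBr mulr1.
  by rewrite ler_wpM2l//; have := expR_ge1Dx (- x); lra.
have DD : D a * x - D b * x <= x ^+ 2.
  by rewrite -mulrBl expr2 ler_wpM2r// (le_trans hi')// ler_piMl.
have x2 : x ^+ 2 <= (g * c) ^+ 2 * (b - a) ^+ 2.
  by rewrite -exprMn lerXn2r// nnegrE (le_trans x0).
apply: (le_trans _ x2); apply: (le_trans _ DD); rewrite ler_norml.
have -> : D b + g * primitive (fun s => D s * f s) b -
    (D a + g * primitive (fun s => D s * f s) a) =
    g * \int[mu]_(s in `]a, b]) (D s * f s) - (D a - D b).
  by rewrite -Px; ring.
by apply/andP; split; lra.
Qed.

End path_calculus.

(** * The compensated martingale *)

Section discounted_martingale.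
Context {R : realType} {d : measure_display} {Omega : measurableType d}.
Variable P : probability Omega R.
Notation mu := (@lebesgue_measure R).
Variables (Gen : R -> set (set Omega)) (N a : R -> Omega -> R) (g c : R).
Hypothesis Gen_sub : forall t : R, <<s Gen t >> `<=` measurable.
Hypothesis Gen_mono : forall s t : R, s <= t -> <<s Gen s >> `<=` <<s Gen t >>.
Hypothesis N_ge0 : forall t w, 0 <= N t w.
Hypothesis N_adapted : forall t : R, 0 <= t ->
  measurable_fun setT (N t : g_sigma_algebraType (Gen t) -> R).
Hypothesis N_rc : right_continuous_paths N.
Hypothesis N_bounded : forall w (t : R), exists K, forall s, 0 <= s <= t -> N s w <= K.
Hypothesis N_martingale : forall (s t : R) (Y : Omega -> R), 0 <= s -> s <= t ->
  measurable_fun setT (Y : g_sigma_algebraType (Gen s) -> R) -> (forall w, 0 <= Y w) ->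
  (\int[P]_w (Y w * N t w)%:E = \int[P]_w (Y w * N s w)%:E)%E.
Hypothesis a_adapted : forall t : R, 0 <= t ->
  measurable_fun setT (a t : g_sigma_algebraType (Gen t) -> R).
Hypothesis a_rc : right_continuous_paths a.
Hypothesis a_itv : forall (t : R) w, 0 <= t -> 0 <= a t w <= c.
Hypothesis g_ge0 : 0 <= g.

Definition discount t w := expR (- (g * primitive (a^~ w) t)).
Definition discounted t w := N t w * discount t w.
Definition compensated t w :=
  discounted t w + g * primitive (fun s => discounted s w * a s w) t.

Let monoF (s t : R) (f : Omega -> R) : s <= t ->
  measurable_fun setT (f : g_sigma_algebraType (Gen s) -> R) ->
  measurable_fun setT (f : g_sigma_algebraType (Gen t) -> R).
Proof. by move=> st; apply: sub_measurable_fun; exact: Gen_mono. Qed.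

Let subF (t : R) (f : Omega -> R) :
  measurable_fun setT (f : g_sigma_algebraType (Gen t) -> R) -> measurable_fun setT f.
Proof. by apply: sub_measurable_funT; exact: Gen_sub. Qed.

Let a_rate w : bounded_rate c (a^~ w).
Proof.
split; last by move=> s; exact: a_itv.
by apply: measurable_path => // t t0; exact: subF (a_adapted t0).
Qed.

Let discount_ge0 t w : 0 <= discount t w. Proof. exact: expR_ge0. Qed.

Let discount_le1 (t : R) w : 0 <= t -> discount t w <= 1.
Proof.
move=> t0; rewrite -[leRHS]expR0 ler_expR oppr_le0 mulr_ge0//.
exact: primitive_ge0 (a_rate w) t0.
Qed.

Lemma primitive_adapted (t : R) (Y : R -> Omega -> R) : 0 <= t ->
  (forall s : R, 0 <= s -> measurable_fun setT (Y s : g_sigma_algebraType (Gen s) -> R)) ->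
  right_continuous_paths Y -> (forall (s : R) w, 0 <= s -> 0 <= Y s w) ->
  measurable_fun setT ((fun w => primitive (Y^~ w) t) : g_sigma_algebraType (Gen t) -> R).
Proof.
move=> t0 mY rcY Y0; apply: measurableT_comp => //.
apply: (@measurable_integral_process_upto _ _ (g_sigma_algebraType (Gen t)) Y) => //.
by move=> s /andP[s0 st]; exact: monoF st (mY s s0).
Qed.

Lemma discount_adapted (t : R) : 0 <= t ->
  measurable_fun setT (discount t : g_sigma_algebraType (Gen t) -> R).
Proof.
move=> t0; apply: measurableT_comp => //; apply: measurableT_comp => //.
apply: measurable_funM => //; apply: primitive_adapted => //.
by move=> s w s0; case/andP: (a_itv w s0).
Qed.

Let primitive_rc k (f : R -> R) (t : R) : bounded_rate k f -> 0 <= t ->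
  primitive f s @[s --> t^'+] --> primitive f t.
Proof.
move=> kf t0; apply/cvgrPdist_lt => e e0.
have [dl dl0 H] := primitive_continuous kf t0 e0.
near=> s; rewrite distrC; apply: H.
  by rewrite (le_trans t0)//; near: s; exact: nbhs_right_ge.
rewrite ger0_norm ?subr_ge0; last by near: s; exact: nbhs_right_ge.
by rewrite ltrBlDl; near: s; apply: nbhs_right_lt; rewrite ltrDl.
Unshelve. all: by end_near. Qed.

Lemma discount_rc : right_continuous_paths discount.
Proof.
move=> w t t0; apply: (cvg_comp _ expR); last exact: continuous_expR.
by apply: cvgN; apply: cvgMr; exact: primitive_rc (a_rate w) t0.
Qed.

Lemma discounted_adapted (t : R) : 0 <= t ->
  measurable_fun setT (discounted t : g_sigma_algebraType (Gen t) -> R).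
Proof. by move=> t0; apply: measurable_funM; [exact: N_adapted|exact: discount_adapted]. Qed.

Lemma discounted_rc : right_continuous_paths discounted.
Proof. by move=> w t t0; apply: cvgM; [exact: N_rc|exact: discount_rc]. Qed.

Lemma discounted_ge0 t w : 0 <= discounted t w. Proof. exact: mulr_ge0. Qed.

Let flow s w := discounted s w * a s w.

Let flow_adapted (t : R) : 0 <= t ->
  measurable_fun setT (flow t : g_sigma_algebraType (Gen t) -> R).
Proof. by move=> t0; apply: measurable_funM; [exact: discounted_adapted|exact: a_adapted]. Qed.

Let flow_rc : right_continuous_paths flow.
Proof. by move=> w t t0; apply: cvgM; [exact: discounted_rc|exact: a_rc]. Qed.

Let flow_ge0 (s : R) w : 0 <= s -> 0 <= flow s w.
Proof. by move=> s0; rewrite mulr_ge0 ?discounted_ge0//; case/andP: (a_itv w s0). Qed.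

(** [N] is bounded only on compact time intervals; freezing the flow at [t] gives a rate with a
    global bound, to which the lemmas on primitives apply. *)
Let flow_rate w (t : R) : 0 <= t ->
  exists K, bounded_rate K (fun s => flow (Num.min s t) w).
Proof.
move=> t0; have [K NK] := N_bounded w t.
exists (K * c); split.
  apply: (@measurable_path _ _ _ (fun s => flow (Num.min s t)) w).
    move=> s s0; apply: (@subF (Num.min s t)); apply: flow_adapted.
    by rewrite le_min s0.
  exact: right_continuous_stopped.
move=> s s0; have st : 0 <= Num.min s t by rewrite le_min s0.
rewrite flow_ge0//=; apply: ler_pM; rewrite ?discounted_ge0//.
- by case/andP: (a_itv w st).
- apply: (@le_trans _ _ (N (Num.min s t) w)); first by rewrite ler_piMr// discount_le1.
  by apply: NK; rewrite st ge_min lexx orbT.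
- by case/andP: (a_itv w st).
Qed.

Let primitive_flow w (s t : R) : s <= t ->
  primitive (flow^~ w) s = primitive (fun s => flow (Num.min s t) w) s.
Proof.
move=> st; apply: eq_Rintegral => u; rewrite inE /= in_itv /= => /andP[_ us].
by rewrite min_l// (le_trans us).
Qed.

Lemma discounted_flow_integrable w (t : R) : 0 <= t ->
  mu.-integrable `[0, t] (EFin \o (fun s => discounted s w * a s w)).
Proof.
move=> t0; have [K fK] := flow_rate w t0.
have : mu.-integrable (`[0, t]%classic : set R) (EFin \o (fun s => flow (Num.min s t) w)).
  apply: bounded_rate_integrable fK _ _.
    by move=> s; rewrite /= in_itv /= => /andP[].
  by rewrite lebesgue_measure_itv /=; case: ifP => // _; rewrite -EFinD ltry.
apply: eq_integrable => // s.
by rewrite inE /= in_itv /= => /andP[_ st]; rewrite min_l.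
Qed.

Lemma compensated_rc : right_continuous_paths compensated.
Proof.
move=> w t t0; apply: cvgD; first exact: discounted_rc.
apply: cvgMr.
have t1 : t < t + 1 by rewrite ltrDl.
have t10 : 0 <= t + 1 by rewrite addr_ge0.
have [K fK] := flow_rate w t10.
rewrite (primitive_flow w (ltW t1)).
apply: cvg_trans (primitive_rc fK t0).
apply: near_eq_cvg; near=> s; rewrite -primitive_flow//.
by near: s; exact: nbhs_right_le.
Unshelve. all: by end_near. Qed.

Lemma compensated_adapted (t : R) : 0 <= t ->
  measurable_fun setT (compensated t : g_sigma_algebraType (Gen t) -> R).
Proof.
move=> t0; apply: measurable_funD; first exact: discounted_adapted.
by apply: measurable_funM => //; exact: (primitive_adapted t0 flow_adapted flow_rc).
Qed.

Lemma compensated_ge0 t w : 0 <= compensated t w.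
Proof.
rewrite addr_ge0 ?discounted_ge0// mulr_ge0//; apply: Rintegral_ge0 => s.
by rewrite /= in_itv /= => /andP[s0 _]; exact: flow_ge0.
Qed.

Let N_martingale_set (s t : R) (Y : Omega -> R) A : 0 <= s -> s <= t ->
  <<s Gen s >> A ->
  measurable_fun setT (Y : g_sigma_algebraType (Gen s) -> R) -> (forall w, 0 <= Y w) ->
  (\int[P]_(w in A) (Y w * N t w)%:E = \int[P]_(w in A) (Y w * N s w)%:E)%E.
Proof.
move=> s0 st FA mY Y0.
have E u : (\int[P]_(w in A) (Y w * N u w)%:E
    = \int[P]_w (Y w * \1_A w * N u w)%:E)%E.
  rewrite integral_mkcond; apply: eq_integral => w _; rewrite patchE indicE.
  by case: ifPn => _; rewrite ?mulr1// mulr0 mul0r.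
rewrite !E; apply: N_martingale => //; last by move=> w; rewrite mulr_ge0.
exact: measurable_funM.
Qed.

(** Against a weight known at time [s], [N s] and [N T] have the same expectation. Hence the flow
    over []t, T]] may be computed with [N T] in place of [N s]; [g] times it is then
    [N T * (discount t - discount T)] on each path. Adding [discounted T] leaves [N T * discount t],
    whose expectation on [A] is that of [discounted t]. *)
Lemma compensated_martingale (t T : R) A : 0 <= t -> t <= T -> <<s Gen t >> A ->
  (\int[P]_(w in A) (compensated t w)%:E = \int[P]_(w in A) (compensated T w)%:E)%E.
Proof.
move=> t0 tT FA; have T0 := le_trans t0 tT; have mA := Gen_sub FA.
pose D := `]t, T]%classic : set R.
have D0 : D `<=` [set s | 0 <= s].
  by move=> s; rewrite /D /= in_itv /= => /andP[/ltW ts _]; exact: le_trans ts.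
have Dt s : D s -> t <= s by rewrite /D /= in_itv /= => /andP[/ltW].
have DT s : D s -> s <= T by rewrite /D /= in_itv /= => /andP[].
have mD : measurable D by exact: measurable_itv.
have muD : (mu D < +oo)%E.
  by rewrite lebesgue_measure_itv /=; case: ifP => // _; rewrite -EFinD ltry.
pose flowT s w := N T w * (discount s w * a s w).
have flowT_ge0 s w : 0 <= s -> 0 <= flowT s w.
  by move=> s0; rewrite !mulr_ge0//; case/andP: (a_itv w s0).
have mflowT s : 0 <= s -> measurable_fun setT (flowT s).
  move=> s0; apply: measurable_funM; first exact: subF (N_adapted T0).
  by apply: measurable_funM; [exact: subF (discount_adapted s0)|exact: subF (a_adapted s0)].
have rcflowT : right_continuous_paths flowT.
  by move=> w s s0; apply: cvgMr; apply: cvgM; [exact: discount_rc|exact: a_rc].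
have mflow s : 0 <= s -> measurable_fun setT (flow s).
  by move=> s0; exact: subF (flow_adapted s0).
pose J w := (\int[mu]_(s in D) (flow s w)%:E)%E.
pose JT w := (\int[mu]_(s in D) (flowT s w)%:E)%E.
have mJ : measurable_fun setT J by exact: measurable_integral_process.
have mJT : measurable_fun setT JT by exact: measurable_integral_process.
have J0 w : (0 <= J w)%E by apply: integral_ge0 => s /D0 s0; rewrite lee_fin flow_ge0.
have JT0 w : (0 <= JT w)%E by apply: integral_ge0 => s /D0 s0; rewrite lee_fin flowT_ge0.
(* Tonelli moves the expectation inside, where [discount s * a s] and the event [A] are known at
   time [s], so the martingale property of [N] applies for each fixed [s]. *)
have intJ : (\int[P]_(w in A) JT w = \int[P]_(w in A) J w)%E.
  rewrite /JT /J !tonelli_process//; apply: eq_integral => s; rewrite inE => Ds.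
  have s0 := D0 s Ds.
  have FsA : <<s Gen s >> A by exact: Gen_mono (Dt s Ds) _ FA.
  have /(N_martingale_set s0 (DT s Ds) FsA) H :
      measurable_fun setT ((fun w => discount s w * a s w) : g_sigma_algebraType (Gen s) -> R).
    by apply: measurable_funM; [exact: discount_adapted|exact: a_adapted].
  rewrite (eq_integral (fun w => (discount s w * a s w * N T w)%:E)); last first.
    by move=> w _; rewrite /flowT mulrC.
  rewrite H; last by move=> w; rewrite mulr_ge0//; case/andP: (a_itv w s0).
  by apply: eq_integral => w _; rewrite /flow /discounted mulrC mulrA.
(* With [N T] constant in [s], the time integral telescopes on each path by [discount_increment]. *)
have Tw w : ((N T w * discount t w)%:E = (discounted T w)%:E + g%:E * JT w)%E.
  have Drate := bounded_rate_discount (a_rate w) g_ge0.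
  have Dint := bounded_rate_integrable Drate D0 muD.
  have -> : JT w = (N T w * \int[mu]_(s in D) (discount s w * a s w))%:E.
    rewrite /JT EFinM /Rintegral fineK; last exact: integrable_fin_num.
    by rewrite -integralZl.
  rewrite -EFinM -EFinD mulrCA (discount_increment (a_rate w) g_ge0 t0 tT).
  by rewrite /discounted -mulrDr addrC subrK.
have Gw w : ((compensated T w)%:E =
    (discounted T w)%:E + g%:E * J w + g%:E * (primitive (flow^~ w) t)%:E)%E.
  have [K fK] := flow_rate w T0.
  have fint := bounded_rate_integrable fK D0 muD.
  have -> : J w = (primitive (flow^~ w) T - primitive (flow^~ w) t)%:E.
    rewrite (primitive_flow w tT) (primitive_flow w (lexx T)).
    rewrite (primitive_increment fK t0 tT) /Rintegral fineK; last exact: integrable_fin_num.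
    by apply: eq_integral => s; rewrite inE => /DT sT; rewrite min_l.
  by rewrite -!EFinM -!EFinD /compensated -/(flow^~ w); congr EFin; rewrite /flow; ring.
have mprim : measurable_fun setT (fun w => primitive (flow^~ w) t).
  exact: subF (primitive_adapted t0 flow_adapted flow_rc flow_ge0).
have prim0 w : 0 <= primitive (flow^~ w) t.
  by apply: Rintegral_ge0 => s; rewrite /= in_itv /= => /andP[s0 _]; exact: flow_ge0.
have mdT := subF (discounted_adapted T0); have mdt := subF (discounted_adapted t0).
have mgp : measurable_fun A (fun w => g%:E * (primitive (flow^~ w) t)%:E)%E.
  by apply: measurable_funTS; apply: emeasurable_funM => //; exact/measurable_EFinP.
have gp0 w : (0 <= g%:E * (primitive (flow^~ w) t)%:E)%E.
  by apply: mule_ge0; rewrite lee_fin ?prim0.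
have mgJ (f : Omega -> \bar R) : measurable_fun setT f ->
    measurable_fun A (fun w => g%:E * f w)%E.
  by move=> mf; apply: measurable_funTS; exact: emeasurable_funM.
have mdTA : measurable_fun A (fun w => (discounted T w)%:E).
  apply/measurable_EFinP; exact: measurable_funTS mdT.
have Gt w : ((compensated t w)%:E =
    (discounted t w)%:E + g%:E * (primitive (flow^~ w) t)%:E)%E by [].
have -> : (\int[P]_(w in A) (compensated t w)%:E = \int[P]_(w in A)
    ((discounted t w)%:E + g%:E * (primitive (flow^~ w) t)%:E))%E.
  by apply: eq_integral => w _; exact: Gt.
have -> : (\int[P]_(w in A) (compensated T w)%:E = \int[P]_(w in A)
    ((discounted T w)%:E + g%:E * J w + g%:E * (primitive (flow^~ w) t)%:E))%E.
  by apply: eq_integral => w _; exact: Gw.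
clear Gt Gw.
have addE (f h : Omega -> \bar R) : (forall w, (0 <= f w)%E) ->
    measurable_fun A f -> (forall w, (0 <= h w)%E) -> measurable_fun A h ->
    (\int[P]_(w in A) (f w + h w) = \int[P]_(w in A) f w + \int[P]_(w in A) h w)%E.
  move=> f0 mf h0 mh; apply: ge0_integralD;
    [exact: mA|move=> w _; exact: f0|exact: mf|move=> w _; exact: h0|exact: mh].
have mulE (f : Omega -> \bar R) : (forall w, (0 <= f w)%E) -> measurable_fun setT f ->
    (\int[P]_(w in A) (g%:E * f w) = g%:E * \int[P]_(w in A) f w)%E.
  move=> f0 mf; apply: ge0_integralZl_EFin => //; exact: measurable_funTS mf.
have dT0 w : (0 <= (discounted T w)%:E)%E by rewrite lee_fin discounted_ge0.
have dt0 w : (0 <= (discounted t w)%:E)%E by rewrite lee_fin discounted_ge0.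
have gJ0 w : (0 <= g%:E * J w)%E by apply: mule_ge0; [rewrite lee_fin|exact: J0].
have gJT0 w : (0 <= g%:E * JT w)%E by apply: mule_ge0; [rewrite lee_fin|exact: JT0].
have mdtA : measurable_fun A (fun w => (discounted t w)%:E).
  apply/measurable_EFinP; exact: measurable_funTS mdt.
have dtE : (\int[P]_(w in A) (discounted t w)%:E =
    \int[P]_(w in A) ((discounted T w)%:E + g%:E * JT w))%E.
  transitivity (\int[P]_(w in A) (discount t w * N t w)%:E)%E.
    by apply: eq_integral => w _; rewrite /discounted mulrC.
  transitivity (\int[P]_(w in A) (discount t w * N T w)%:E)%E.
    by rewrite (N_martingale_set t0 tT FA (discount_adapted t0)).
  by apply: eq_integral => w _; rewrite -Tw mulrC.
have dJ0 w : (0 <= (discounted T w)%:E + g%:E * J w)%E by apply: adde_ge0.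
rewrite (addE _ _ dt0 mdtA gp0 mgp) dtE (addE _ _ dT0 mdTA gJT0 (mgJ _ mJT)).
rewrite (addE _ _ dJ0 (emeasurable_funD mdTA (mgJ _ mJ)) gp0 mgp).
rewrite (addE _ _ dT0 mdTA gJ0 (mgJ _ mJ)) (mulE _ J0 mJ) (mulE _ JT0 mJT).
by rewrite intJ.
Qed.

End discounted_martingale.

(** * Hitting times of continuous paths *)

Notation halfline_continuous f := {within `[0, +oo[%classic, continuous f}.

Section halfline_continuity.
Context {R : realType}.
Implicit Types f : R -> R.

Lemma halfline_continuousP f : halfline_continuous f <->
  forall t : R, 0 <= t -> forall e : R, 0 < e -> exists2 dl : R, 0 < dl &
    forall s : R, 0 <= s -> `|s - t| < dl -> `|f s - f t| < e.
Proof.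
rewrite subspace_continuousP; split => [fc t t0 e e0|fc t /=].
  have t0' : (`[0, +oo[%classic : set R) t by rewrite /= in_itv /= t0.
  have /cvgrPdist_lt/(_ _ e0) := fc t t0'.
  rewrite near_withinE => /nbhs_ballP[dl /= dl0 H]; exists dl => // s s0 st.
  rewrite distrC; apply: H; last by rewrite /= in_itv /= s0.
  by rewrite /ball /= distrC.
rewrite in_itv /= andbT => t0; apply/cvgrPdist_lt => e e0.
have [dl dl0 H] := fc t t0 e e0.
rewrite near_withinE; apply/nbhs_ballP; exists dl => //= s.
rewrite /ball /= distrC => st; rewrite in_itv /= andbT => s0.
by rewrite distrC; exact: H.
Qed.

Lemma halfline_continuous_right f (t : R) : halfline_continuous f -> 0 <= t ->
  f s @[s --> t^'+] --> f t.
Proof.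
move=> /halfline_continuousP fc t0; apply/cvgrPdist_lt => e e0.
have [dl dl0 H] := fc t t0 e e0.
near=> s; rewrite distrC; apply: H.
  by rewrite (le_trans t0)//; near: s; exact: nbhs_right_ge.
rewrite ger0_norm ?subr_ge0; last by near: s; exact: nbhs_right_ge.
by rewrite ltrBlDl; near: s; apply: nbhs_right_lt; rewrite ltrDl.
Unshelve. all: by end_near. Qed.

Lemma halfline_continuous_bounded f (t : R) : halfline_continuous f -> 0 <= t ->
  exists K, forall s, 0 <= s <= t -> f s <= K.
Proof.
move=> fc t0.
have fct : {within (`[0, t]%classic : set R), continuous f}.
  apply: continuous_subspaceW fc => s /=.
  by rewrite !in_itv /= andbT => /andP[].
have [K _ HK] := EVT_max t0 fct; exists (f K) => s st; apply: HK.
by rewrite in_itv.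
Qed.

(** Applied to a path of the surplus this is [ruin_time] up to conversion. *)
Definition hitting_time f : \bar R :=
  ereal_inf [set t%:E | t in [set t : R | 0 <= t /\ f t <= 0]].

Lemma hitting_time_ge0 f : (0 <= hitting_time f)%E.
Proof. by apply: le_ereal_inf_tmp => _ [t [t0 _] <-]; rewrite lee_fin. Qed.

Lemma lt_hitting_time f (t : R) : 0 <= t -> (t%:E < hitting_time f)%E -> 0 < f t.
Proof.
move=> t0; rewrite !ltNge; apply: contra => ft; apply: ereal_inf_lbound.
by exists t.
Qed.

Lemma hitting_time_attained f (t : R) : halfline_continuous f ->
  hitting_time f = t%:E -> f t <= 0.
Proof.
move=> /halfline_continuousP fc ft.
have t0 : 0 <= t by rewrite -lee_fin -ft hitting_time_ge0.
rewrite leNgt; apply/negP => ft0.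
have [dl dl0 H] := fc t t0 (f t) ft0.
have /ereal_inf_lt[_ [s [s0 fs] <-]] : (hitting_time f < (t + dl)%:E)%E.
  by rewrite ft lte_fin ltrDl.
rewrite lte_fin => std.
have ts : t <= s by rewrite -lee_fin -ft; apply: ereal_inf_lbound; exists s.
have : `|f s - f t| < f t by apply: H => //; rewrite ger0_norm ?subr_ge0// ltrBlDl.
by rewrite ltr_norml => /andP[]; lra.
Qed.

Lemma hitting_time_le_ge0 f (t : R) : halfline_continuous f -> 0 <= f 0 ->
  0 <= t -> (t%:E <= hitting_time f)%E -> 0 <= f t.
Proof.
move=> /halfline_continuousP fc f0 t0 tf; rewrite leNgt; apply/negP => ft0.
(* At [t = 0] no earlier time is available for comparison, and [0 <= f 0] settles the case. *)
have tpos : 0 < t.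
  by rewrite lt_neqAle t0 andbT; apply/eqP => t0E; move: ft0; rewrite -t0E ltNge f0.
have nft : 0 < - f t by rewrite oppr_gt0.
have [dl dl0 H] := fc t t0 _ nft.
pose s := Num.max 0 (t - dl / 2).
have s0 : 0 <= s by rewrite le_max lexx.
have st : s < t by rewrite gt_max tpos; lra.
have sdl : t - dl / 2 <= s by rewrite le_max lexx orbT.
have fs : 0 < f s by apply: lt_hitting_time => //; apply: lt_le_trans tf; rewrite lte_fin.
have : `|f s - f t| < - f t by apply: H => //; rewrite ltr0_norm ?subr_lt0//; lra.
by rewrite ltr_norml => /andP[]; lra.
Qed.

(** A continuous path reaches the nonpositive half-line by time [t] exactly when its minimum on
    [[0, t]] is nonpositive, which a countable dense set of times detects. Rationals clamped to
    [[0, 1]] and scaled by [t] form such a set for any real [t], both endpoints included. *)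
Lemma hitting_time_leP f (t : R) : halfline_continuous f -> 0 <= t ->
  (hitting_time f <= t%:E)%E <->
  forall n : nat, exists q : rat,
    f (t * Num.max 0 (Num.min 1 (ratr q))) < n.+1%:R^-1.
Proof.
move=> fc0 t0; have /halfline_continuousP fc := fc0; split => [ft n|H].
  have [s] : exists s, hitting_time f = s%:E.
    by move: ft (hitting_time_ge0 f); case: (hitting_time f) => // s; exists s.
  move=> fsE; have s0 : 0 <= s by rewrite -lee_fin -fsE hitting_time_ge0.
  have st : s <= t by rewrite -lee_fin -fsE.
  have fs := hitting_time_attained fc0 fsE.
  have n0 : 0 < n.+1%:R^-1 :> R by rewrite invr_gt0.
  have [dl dl0 Hdl] := fc s s0 _ n0.
  suff [q qs] : exists q : rat, `|t * Num.max 0 (Num.min 1 (ratr q)) - s| < dl.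
    exists q; have : `|f (t * Num.max 0 (Num.min 1 (ratr q))) - f s| < n.+1%:R^-1.
      by apply: Hdl => //; rewrite mulr_ge0// le_max lexx.
    by rewrite ltr_norml ltrBlDr => /andP[_ /lt_le_trans]; apply; rewrite gerDl.
  have [tpos|tle0] := ltP 0 t; last first.
    have -> : t = 0 by apply/le_anti; rewrite tle0.
    by exists 0; rewrite mul0r sub0r normrN ger0_norm//; lra.
  have [q] := @rat_in_itvoo R (s / t - dl / t) (s / t + dl / t)
    ltac:(by rewrite ltrD2l gtrN// divr_gt0).
  rewrite in_itv /= => /andP[q1 q2]; exists q.
  have sE : s = t * (s / t) by rewrite mulrC divfK// gt_eqF.
  rewrite [X in _ - X]sE -mulrBr normrM (gtr0_norm tpos) -ltr_pdivlMl// [X in _ < X]mulrC.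
  have u0 : 0 <= s / t by rewrite divr_ge0.
  have u1 : s / t <= 1 by rewrite ler_pdivrMr// mul1r.
  move: u0 u1 q1 q2; move: (s / t) (dl / t) (ratr q) => u v p u0 u1 q1 q2.
  rewrite ltr_norml /Num.min /Num.max.
  by case: (ltP 1 p) => h1; [rewrite ltr01|case: (ltP 0 p) => h2];
    apply/andP; split; lra.
rewrite leNgt; apply/negP => tf.
have fct : {within (`[0, t]%classic : set R), continuous f}.
  apply: continuous_subspaceW fc0 => s /=.
  by rewrite !in_itv /= andbT => /andP[].
have [m mt Hm] := EVT_min t0 fct.
have fm : 0 < f m.
  move: mt; rewrite in_itv /= => /andP[m0 mt]; apply: lt_hitting_time => //.
  by apply: le_lt_trans tf; rewrite lee_fin.
(* The index makes [n.+1%:R^-1] at most the positive minimum [f m], which no sampled value can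
   undercut. *)
have [q] := H (truncn (f m)^-1).
have /Hm fq : t * Num.max 0 (Num.min 1 (ratr q)) \in `[0, t].
  rewrite in_itv /= mulr_ge0 ?le_max ?lexx//= ler_piMr// ge_max ler01 /=.
  by rewrite ge_min lexx.
apply/negP; rewrite -leNgt (le_trans _ fq)// -[leRHS]invrK lef_pV2 ?posrE ?invr_gt0//.
have fm0 : 0 <= (f m)^-1 by rewrite invr_ge0 ltW.
by have /andP[_ /ltW] := truncn_itv fm0.
Qed.

End halfline_continuity.

(** Taking for [S] the space [Omega] with the sigma-algebra of time [t] turns this into the stopping
    time property. *)
Lemma hitting_time_stopping {R : realType} {d : measure_display}
    {S : measurableType d} (X : R -> S -> R) (t : R) :
  0 <= t -> (forall w, halfline_continuous (X^~ w)) ->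
  (forall s, 0 <= s <= t -> measurable_fun setT (X s)) ->
  measurable [set w | (hitting_time (X^~ w) <= t%:E)%E].
Proof.
move=> t0 Xc mX.
rewrite (_ : [set w | _] = \bigcap_n \bigcup_(q : rat)
    (X (t * Num.max 0 (Num.min 1 (ratr q))) @^-1` [set y | y < n.+1%:R^-1])); last first.
  apply/seteqP; split => w /=.
    move=> /(hitting_time_leP (Xc w) t0).1 H n _; have [q qn] := H n.
    by exists q.
  move=> H; apply/(hitting_time_leP (Xc w) t0) => n.
  by have [q _ qn] := H n I; exists q.
apply: bigcapT_measurable => n; apply: bigcupT_measurable_rat => q.
rewrite -[X in measurable X]setTI; apply: mX.
- rewrite mulr_ge0 ?le_max ?lexx//= ler_piMr// ge_max ler01 /=.
  by rewrite ge_min lexx.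
- exact: measurableT.
rewrite (_ : [set y | _] = `]-oo, n.+1%:R^-1[%classic)//.
Qed.

(** * Exponential Brownian martingales *)

Section brownian_motion.
Context {R : realType} {d : measure_display} {Omega : measurableType d}.
Variables (P : probability Omega R) (W : R -> Omega -> R).
Hypothesis BM : standard_BM P W.

(* Chosen so that [<<s aug_gen t >>] is [aug_filtration P W t]. *)
Definition aug_gen (t : R) : set (set Omega) := natural_gen W t `|` null_events P.

Lemma BM_measurable (t : R) : 0 <= t -> measurable_fun setT (W t).
Proof. by case: BM => mW _ _ _; exact: mW. Qed.

Lemma aug_gen_measurable (t : R) : <<s aug_gen t >> `<=` measurable.
Proof. exact: (aug_filtration_measurable (P := P) BM_measurable). Qed.

Lemma aug_gen_mono (s t : R) : s <= t -> <<s aug_gen s >> `<=` <<s aug_gen t >>.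
Proof. exact: sub_aug_filtration. Qed.

Lemma BM_adapted (t : R) : 0 <= t ->
  measurable_fun setT (W t : g_sigma_algebraType (aug_gen t) -> R).
Proof.
move=> t0 _ B mB; rewrite setTI; apply: sub_sigma_algebra; left.
by exists t, B; split => //; rewrite t0 lexx.
Qed.

Definition exp_BM (lambda t : R) (w : Omega) : R :=
  expR (lambda * W t w - lambda ^+ 2 / 2 * t).

Lemma exp_BM_adapted (lambda t : R) : 0 <= t ->
  measurable_fun setT (exp_BM lambda t : g_sigma_algebraType (aug_gen t) -> R).
Proof.
move=> t0; apply: measurableT_comp => //; apply: measurable_funB => //.
by apply: measurable_funM => //; exact: BM_adapted.
Qed.

Lemma exp_BM_continuous (lambda : R) w :
  {within (`[0, +oo[%classic : set R), continuous (exp_BM lambda ^~ w)}.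
Proof.
case: BM => _ _ Wc _.
apply/subspace_continuousP => t At.
apply: (cvg_comp _ expR); last exact: continuous_expR.
apply: cvgB; apply: cvgMr; last exact: cvg_within.
by move: t At; apply/subspace_continuousP; exact: Wc.
Qed.

(** The increment after [s] is independent of [Y * exp_BM lambda s], and its normalised exponential
    has mean 1 by the Gaussian moment generating function. Testing against variables [Y] rather than
    events is what the Tonelli argument needs, its weights being products of discount, rate and
    indicator. *)
Lemma exp_BM_martingale (lambda s t : R) (Y : Omega -> R) : 0 <= s -> s <= t ->
  measurable_fun setT (Y : g_sigma_algebraType (aug_gen s) -> R) -> (forall w, 0 <= Y w) ->
  (\int[P]_w (Y w * exp_BM lambda t w)%:E = \int[P]_w (Y w * exp_BM lambda s w)%:E)%E.
Proof.
move=> s0; rewrite le_eqVlt => /predU1P[<-//|st] mY Y0.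
have t0 := le_trans s0 (ltW st).
have [mW _ _ /(_ s t s0 st)[ind law]] := BM.
pose X w := W t w - W s w.
have mX : measurable_fun setT X by apply: measurable_funB; apply: mW.
pose k := expR (- (lambda ^+ 2 / 2 * (t - s))).
have ts : 0 < Num.sqrt (t - s) by rewrite sqrtr_gt0 subr_gt0.
transitivity (\int[P]_w ((Y w * exp_BM lambda s w) * (k * expR (lambda * X w)))%:E)%E.
  apply: eq_integral => w _; congr EFin; rewrite -mulrA; congr (_ * _).
  by rewrite /exp_BM /k -!expRD; congr expR; rewrite /X; ring.
rewrite (indep_expectation (f := fun y => k * expR (lambda * y))
  (@aug_gen_measurable s) mX (indep_of_aug_filtration mW mX ind)
  (measurable_funM mY (exp_BM_adapted lambda s0))); first last.
- by move=> y; rewrite mulr_ge0// expR_ge0.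
- apply: measurable_funM => //; apply: measurableT_comp => //; exact: measurable_funM.
- by move=> w; rewrite mulr_ge0// expR_ge0.
rewrite -[RHS]mule1; congr (_ * _)%E.
have mexp : measurable_fun setT (fun y : R => expR (lambda * y)).
  by apply: measurableT_comp => //; exact: measurable_funM.
have mf : measurable_fun setT (fun y : R => (k * expR (lambda * y))%:E).
  by apply/measurable_EFinP; exact: measurable_funM.
have f0 (y : R) : (0 <= (k * expR (lambda * y))%:E)%E.
  by rewrite lee_fin mulr_ge0// expR_ge0.
transitivity (\int[normal_prob 0 (Num.sqrt (t - s))]_y (k * expR (lambda * y))%:E)%E.
  (* [normal_prob] lives on another canonical copy of the Borel space. *)
  pose idTR : measurableTypeR R -> R := idfun.
  have midTR : measurable_fun setT idTR := @measurable_id _ _ setT.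
  pose muX : {measure set R -> \bar R} :=
    distribution P (mfun_Sub (mem_set mX) : {RV P >-> R}).
  pose nu : {measure set R -> \bar R} :=
    distribution (normal_prob 0 (Num.sqrt (t - s)))
      (mfun_Sub (mem_set midTR) : {mfun (measurableTypeR R) >-> R}).
  transitivity (\int[nu]_y (k * expR (lambda * y))%:E)%E.
    rewrite -[LHS]/(\int[muX]_y (k * expR (lambda * y))%:E)%E.
    by apply: eq_measure_integral => B mB _; exact: law.
  rewrite -[LHS]/(\int[pushforward (normal_prob 0 (Num.sqrt (t - s))) idTR]_y
    (k * expR (lambda * y))%:E)%E.
  by rewrite ge0_integral_pushforward.
under eq_integral do rewrite EFinM.
rewrite ge0_integralZl_EFin; [|exact: measurableT|by move=> y _; rewrite lee_fin expR_ge0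
  |exact/measurable_EFinP|exact: expR_ge0].
rewrite normal_mgf// sqr_sqrtr ?subr_ge0 ?(ltW st)//.
rewrite -EFinM /k -expRD (_ : _ + _ = 0) ?expR0//; ring.
Qed.

End brownian_motion.

(** * The exponent gamma as the root of a quadratic equation *)

Section gamma_const.
Context {R : realType}.
Variables mu sigma cbar r : R.
Hypotheses (sigma_gt0 : 0 < sigma) (r_gt0 : 0 < r).
Notation g := (gamma_const mu sigma cbar r).

Let sqrt_arg_ge0 : 0 <= (mu - cbar) ^+ 2 + 2 * sigma ^+ 2 * r.
Proof. by rewrite addr_ge0 ?sqr_ge0// !mulr_ge0 ?sqr_ge0// ltW. Qed.

Lemma gamma_const_ge0 : cbar <= mu -> 0 <= g.
Proof. by move=> cm; rewrite divr_ge0 ?sqr_ge0// addr_ge0 ?sqrtr_ge0// subr_ge0. Qed.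

(** For [lambda = - (g * sigma)] the compensator [lambda ^+ 2 / 2 * t] of the exponential martingale
    thereby splits into the discount exponent [r * t] and the drift term [g * (mu - cbar) * t]. *)
Lemma gamma_const_root : (g * sigma) ^+ 2 / 2 = g * (mu - cbar) + r.
Proof.
have sn0 : sigma != 0 by rewrite gt_eqF.
have := sqr_sqrtr sqrt_arg_ge0; rewrite /gamma_const.
move: (Num.sqrt _) => s sE.
have -> : ((s + (mu - cbar)) / sigma ^+ 2 * sigma) ^+ 2 / 2 =
    (s ^+ 2 + 2 * s * (mu - cbar) + (mu - cbar) ^+ 2) / sigma ^+ 2 / 2 by field.
by rewrite sE; field.
Qed.

Lemma gamma_const_le : 0 < cbar -> cbar <= mu -> 2 * mu * cbar <= sigma ^+ 2 * r ->
  cbar * g <= r.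
Proof.
move=> c0 cm H; have s20 : 0 < sigma ^+ 2 by rewrite exprn_gt0.
rewrite /gamma_const mulrA ler_pdivrMr// mulrDr -lerBrDr.
(* Isolating the square root leaves this right-hand side; its sign permits squaring. *)
have rhs0 : 0 <= r * sigma ^+ 2 - cbar * (mu - cbar).
  have : cbar * (mu - cbar) <= 2 * mu * cbar by nra.
  by lra.
rewrite -(ler_pXn2r (n := 2))// ?nnegrE ?mulr_ge0 ?sqrtr_ge0 ?(ltW c0)//.
rewrite exprMn sqr_sqrtr//.
(* This product is exactly the difference of the two squares. *)
have : 0 <= r * sigma ^+ 2 * (sigma ^+ 2 * r - 2 * mu * cbar).
  by rewrite mulr_ge0 ?subr_ge0// mulr_ge0// ltW.
by move: (sigma ^+ 2) => q; nra.
Qed.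

End gamma_const.

(** * Integrals of the discount factor *)

Section exponential_discounting.
Context {R : realType}.
Variable r : R.
Hypothesis r_gt0 : 0 < r.
Notation leb := (@lebesgue_measure R).
Notation e := (fun s : R => expR (- (r * s))).

Lemma exp_rate : bounded_rate 1 e.
Proof.
split; last first.
  move=> s s0; rewrite expR_ge0 /= -[leRHS]expR0 ler_expR oppr_le0.
  by rewrite mulr_ge0// ltW.
apply: measurable_funTS; apply: measurableT_comp => //; apply: measurableT_comp => //.
Qed.

(** The factor [exp (- r s)] is the discount attached to the constant rate 1, so
    [discount_increment] also yields this elementary integral. *)
Lemma primitive_exp (t : R) : 0 <= t -> r * primitive e t = 1 - e t.
Proof.
move=> t0.
have cst1 : bounded_rate 1 (cst 1 : R -> R).
  by split => // s _ /=; rewrite ler01 lexx.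
have primE (s : R) : 0 <= s -> primitive (cst 1) s = s.
  move=> s0; rewrite /primitive Rintegral_cst//= lebesgue_measure_itv /= lte_fin mul1r.
  case: ltP => [_|s0']; first by rewrite -EFinD /= subr0.
  by apply/le_anti; rewrite s0.
have incE := primitive_increment (bounded_rate_discount cst1 (ltW r_gt0)) (lexx 0) t0.
have := discount_increment cst1 (ltW r_gt0) (lexx 0) t0.
rewrite /= in incE *; rewrite -incE.
rewrite primitive0 subr0 primitive0 mulr0 oppr0 expR0 primE// => <-.
congr (_ * _); apply: eq_Rintegral => s; rewrite inE /= in_itv /= => /andP[s0 _].
by rewrite primE// mulr1.
Qed.

(** The integrand is the exponential density: its total mass is 1 and its mass on [[0, T]] is
    known. *)
Lemma exp_tail (T : R) : 0 < T ->
  (\int[leb]_(s in `]T, +oo[) (r * expR (- (r * s)))%:E <= (expR (- (r * T)))%:E)%E.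
Proof.
move=> T0.
have mpdf : measurable_fun setT (EFin \o exponential_pdf r).
  by apply/measurable_EFinP; exact: measurable_exponential_pdf.
have pdf0 s : (0 <= (exponential_pdf r s)%:E)%E.
  by rewrite lee_fin exponential_pdf_ge0// ltW.
rewrite (_ : integral _ _ _ =
    \int[leb]_(s in `]T, +oo[) (exponential_pdf r s)%:E)%E; last first.
  apply: eq_integral => s; rewrite inE /= in_itv /= andbT => Ts.
  by rewrite exponential_pdfE ?(ltW (lt_trans T0 Ts))// mulNr.
have fin : (1 - expR (- r * T))%:E \is a fin_num by [].
rewrite -(leeD2lE _ _ fin) -EFinD mulNr subrK.
rewrite -[leRHS](integral_exponential_pdf r_gt0).
rewrite [X in (X + _ <= _)%E](_ : _ =
    \int[leb]_(s in `[0%R, T]) (exponential_pdf r s)%:E)%E; last first.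
  by rewrite -mulNr EFinB; apply: esym; exact: exponential_prob_itv0c.
rewrite -ge0_integral_setU//.
- apply: ge0_subset_integral => //; exact: measurableU.
- by apply: measurable_funTS.
- apply/disj_setPS => s [] /=; rewrite !in_itv /= andbT => /andP[_ sT].
  by rewrite ltNge sT.
Qed.

End exponential_discounting.

(** * Stopping at ruin *)

Section bounded_dividends.
Context {R : realType} {d : measure_display} {Omega : measurableType d}.
Variables (P : probability Omega R) (W : R -> Omega -> R) (mu sigma r cbar x : R).
Variable C : R -> Omega -> R.
Hypothesis BM : standard_BM P W.
Hypotheses (sigma_gt0 : 0 < sigma) (r_gt0 : 0 < r) (cbar_gt0 : 0 < cbar).
Hypotheses (cbar_le_mu : cbar <= mu) (x_ge0 : 0 <= x).
Hypothesis C_adapted : adapted (aug_filtration P W) C.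
Hypothesis C_rc : right_continuous_paths C.
Hypothesis C_itv : forall (t : R) w, 0 <= t -> 0 <= C t w <= cbar.

Notation leb := (@lebesgue_measure R).
Notation g := (gamma_const mu sigma cbar r).
Notation K := (cbar / r).

Let a (t : R) (w : Omega) : R := cbar - C t w.
Let X := surplus W mu sigma x C.
Let tau := ruin_time W mu sigma x C.
Let N (t : R) (w : Omega) : R := expR (- (g * x)) * exp_BM W (- (g * sigma)) t w.
Let Z := discounted N a g.
Let G := compensated N a g.
Let Gen := aug_gen P W.

Let g_ge0 : 0 <= g. Proof. exact: gamma_const_ge0. Qed.
Let K_ge0 : 0 <= K. Proof. by rewrite divr_ge0// ltW. Qed.

Let C_meas (t : R) : 0 <= t -> measurable_fun setT (C t : g_sigma_algebraType (Gen t) -> R).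
Proof. by move=> t0 _ B mB; rewrite setTI; exact: C_adapted. Qed.

Let a_adapted (t : R) : 0 <= t -> measurable_fun setT (a t : g_sigma_algebraType (Gen t) -> R).
Proof. by move=> t0; apply: measurable_funB => //; exact: C_meas. Qed.

Let a_rc : right_continuous_paths a.
Proof. by move=> w t t0; apply: cvgB; [exact: cvg_cst|exact: C_rc]. Qed.

Let a_itv (t : R) w : 0 <= t -> 0 <= a t w <= cbar.
Proof. by move=> /(C_itv w)/andP[C0 Cc]; rewrite /a subr_ge0 Cc gerBl. Qed.

Let Gen_sub (t : R) : <<s Gen t >> `<=` measurable.
Proof. exact: aug_gen_measurable. Qed.

Let Gen_mono (s t : R) : s <= t -> <<s Gen s >> `<=` <<s Gen t >>.
Proof. exact: aug_gen_mono. Qed.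

Let rate_of (Y : R -> Omega -> R) w :
  (forall t : R, 0 <= t -> measurable_fun setT (Y t : g_sigma_algebraType (Gen t) -> R)) ->
  right_continuous_paths Y -> (forall t : R, 0 <= t -> 0 <= Y t w <= cbar) ->
  bounded_rate cbar (Y^~ w).
Proof.
move=> mY rcY Yc; split => //; apply: measurable_path => // t t0.
by apply: (sub_measurable_funT (@Gen_sub t)); exact: mY.
Qed.

Let a_rate w : bounded_rate cbar (a^~ w).
Proof. by apply: rate_of => // t; exact: a_itv. Qed.

Let C_rate w : bounded_rate cbar (C^~ w).
Proof. by apply: rate_of => // t; exact: C_itv. Qed.

Let N_ge0 t w : 0 <= N t w. Proof. by rewrite mulr_ge0 ?expR_ge0. Qed.

Let N_adapted (t : R) : 0 <= t -> measurable_fun setT (N t : g_sigma_algebraType (Gen t) -> R).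
Proof. by move=> t0; apply: measurable_funM => //; exact: exp_BM_adapted. Qed.

Let N_rc : right_continuous_paths N.
Proof.
move=> w t t0; apply: cvgMr; apply: halfline_continuous_right => //.
exact: (@exp_BM_continuous _ _ _ _ _ BM (- (g * sigma)) w).
Qed.

Let N_bounded w (t : R) : exists K, forall s, 0 <= s <= t -> N s w <= K.
Proof.
have [t0|t0] := leP 0 t; last first.
  by exists 0 => s /andP[s0 st]; move: (le_lt_trans (le_trans s0 st) t0); rewrite ltxx.
have [k Hk] := halfline_continuous_bounded (@exp_BM_continuous _ _ _ _ _ BM (- (g * sigma)) w) t0.
by exists (expR (- (g * x)) * k) => s st; rewrite ler_wpM2l ?expR_ge0 ?Hk.
Qed.

Let N_martingale (s t : R) (Y : Omega -> R) : 0 <= s -> s <= t ->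
  measurable_fun setT (Y : g_sigma_algebraType (Gen s) -> R) -> (forall w, 0 <= Y w) ->
  (\int[P]_w (Y w * N t w)%:E = \int[P]_w (Y w * N s w)%:E)%E.
Proof.
move=> s0 st mY Y0; rewrite /N.
under eq_integral do rewrite mulrA.
under [RHS]eq_integral do rewrite mulrA.
apply: exp_BM_martingale => //; first exact: measurable_funM.
by move=> w; rewrite mulr_ge0 ?expR_ge0.
Qed.

Let surplusE (t : R) w : 0 <= t ->
  X t w = x + (mu - cbar) * t + primitive (a^~ w) t + sigma * W t w.
Proof.
move=> t0; rewrite /X /surplus; congr (_ + _); rewrite -addrA; congr (_ + _).
have muE : leb (`[0, t]%classic : set R) = t%:E.
  rewrite lebesgue_measure_itv /= lte_fin; case: ltP => [_|t0'].
    by rewrite -EFinD subr0.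
  by rewrite (@le_anti _ _ t 0)// t0'.
have muy : (leb (`[0%R, t]%classic : set R) < +oo)%E by rewrite muE ltry.
have pos : (`[0, t]%classic : set R) `<=` [set s | 0 <= s].
  by move=> s; rewrite /= in_itv /= => /andP[].
transitivity (\int[leb]_(s in `[0, t]) ((mu - cbar) + a s w)).
  by apply: eq_Rintegral => s _; rewrite /a; ring.
rewrite RintegralD//; last 2 first.
- by apply: measurable_bounded_integrable => //; exact: bounded_cst.
- exact: bounded_rate_integrable (a_rate w) pos muy.
by rewrite Rintegral_cst//= muE.
Qed.

Let X0 w : X 0 w = x.
Proof.
rewrite surplusE// mulr0 addr0 primitive0 addr0.
by case: BM => _ W0 _ _; rewrite W0 mulr0 addr0.
Qed.

Let ZE (t : R) w : 0 <= t -> Z t w = expR (- (r * t) - g * X t w).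
Proof.
move=> t0; rewrite /Z /discounted /discount /N /exp_BM -!expRD surplusE//.
have root := gamma_const_root mu cbar sigma_gt0 r_gt0.
by congr expR; rewrite sqrrN root; ring.
Qed.

Let X_continuous w : halfline_continuous (X^~ w).
Proof.
have : halfline_continuous (fun t => x + (mu - cbar) * t + primitive (a^~ w) t + sigma * W t w).
  apply/subspace_continuousP => t At; apply: cvgD; last first.
    apply: cvgMr; move: t At; apply/subspace_continuousP.
    by case: BM => _ _ Wc _; exact: Wc.
  apply: cvgD; last first.
    move: t At; apply/subspace_continuousP/halfline_continuousP => t t0.
    exact: primitive_continuous (a_rate w) t0.
  by apply: cvgD; [exact: cvg_cst|apply: cvgMr; exact: cvg_within].
move=> /halfline_continuousP H; apply/halfline_continuousP => t t0 e e0.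
have [dl dl0 Hdl] := H t t0 e e0; exists dl => // s s0 st.
by rewrite !surplusE//; exact: Hdl.
Qed.

Let X_adapted (t : R) : 0 <= t -> measurable_fun setT (X t : g_sigma_algebraType (Gen t) -> R).
Proof.
move=> t0.
have : measurable_fun setT ((fun w => x + (mu - cbar) * t + primitive (a^~ w) t + sigma * W t w)
    : g_sigma_algebraType (Gen t) -> R).
  apply: measurable_funD; last by apply: measurable_funM => //; exact: BM_adapted.
  apply: measurable_funD => //; apply: primitive_adapted => //.
  by move=> s w s0; case/andP: (a_itv w s0).
by apply: eq_measurable_fun => w _; rewrite surplusE.
Qed.

Let theta (T : R) (w : Omega) : R := fine (Order.min (tau w) T%:E).

Let thetaE T w : 0 <= T -> (theta T w)%:E = Order.min (tau w) T%:E.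
Proof.
move=> T0; rewrite /theta fineK// ge0_fin_numE.
  by rewrite gt_min ltry orbT.
by rewrite le_min hitting_time_ge0 lee_fin.
Qed.

Let theta_itv (T : R) w : 0 <= T -> 0 <= theta T w <= T.
Proof.
move=> T0; rewrite -!lee_fin thetaE// le_min hitting_time_ge0 lee_fin T0 /=.
by rewrite ge_min lexx orbT.
Qed.

Let theta_le_tau (T : R) w : 0 <= T -> ((theta T w)%:E <= tau w)%E.
Proof. by move=> T0; rewrite thetaE// ge_min lexx. Qed.

Let theta_stopping (T t : R) : 0 <= T -> 0 <= t -> <<s Gen t >> [set w | theta T w <= t].
Proof.
move=> T0 t0.
have -> : [set w | theta T w <= t] = if T <= t then setT else [set w | (tau w <= t%:E)%E].
  apply/seteqP; split => w; case: ifPn => // Tt /=; rewrite -lee_fin thetaE// ge_min lee_fin.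
  - by rewrite (negbTE Tt) orbF.
  - by rewrite Tt orbT.
  - by move=> ->.
case: ifP => _; first exact: (@measurableT _ (g_sigma_algebraType (Gen t))).
apply: (@hitting_time_stopping _ _ (g_sigma_algebraType (Gen t)) X t t0 X_continuous).
move=> s /andP[s0 st]; exact: (sub_measurable_fun (Gen_mono st) (X_adapted s0)).
Qed.

Let G_adapted (t : R) : 0 <= t -> measurable_fun setT (G t : g_sigma_algebraType (Gen t) -> R).
Proof. by move=> t0; exact: (compensated_adapted g Gen_sub Gen_mono N_ge0
  N_adapted N_rc a_adapted a_rc a_itv). Qed.

Let G_martingale (t T : R) A : 0 <= t -> t <= T -> <<s Gen t >> A ->
  (\int[P]_(w in A) (G t w)%:E = \int[P]_(w in A) (G T w)%:E)%E.
Proof.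
exact: (compensated_martingale Gen_sub Gen_mono N_ge0 N_adapted N_rc N_bounded
  N_martingale a_adapted a_rc a_itv g_ge0).
Qed.

Let G0 w : G 0 w = expR (- (g * x)).
Proof.
by rewrite /G /compensated primitive0 mulr0 addr0 -/Z ZE// X0 mulr0 oppr0 add0r.
Qed.

Let integral_G (T : R) : 0 <= T -> (\int[P]_w (G T w)%:E = (expR (- (g * x)))%:E)%E.
Proof.
move=> T0; rewrite -(G_martingale (lexx 0) T0); last first.
  exact: (@measurableT _ (g_sigma_algebraType (Gen 0))).
under eq_integral do rewrite G0.
by rewrite integral_cst//= probability_setT mule1.
Qed.

Let G_ge0 t w : 0 <= G t w.
Proof. exact: (compensated_ge0 N_ge0 a_itv g_ge0). Qed.

Let G_rc : right_continuous_paths G.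
Proof.
exact: (compensated_rc Gen_sub Gen_mono N_ge0 N_adapted N_rc N_bounded a_adapted a_rc
  a_itv g_ge0).
Qed.

Let stopped_G T w := G (theta T w) w.

Let measurable_stopped_G (T : R) : 0 < T -> measurable_fun setT (stopped_G T).
Proof.
move=> T0; apply: (measurable_optional_stopping (Gen := Gen) (G := G) (theta := theta T) T0) => //.
- by move=> t /andP[t0 _]; exact: G_adapted.
- by move=> w; apply: theta_itv; exact: ltW.
- by move=> t; apply: theta_stopping; exact: ltW.
Qed.

Let integral_stopped_G (T : R) : 0 < T ->
  (\int[P]_w (stopped_G T w)%:E = (expR (- (g * x)))%:E)%E.
Proof.
move=> T0; have T0' := ltW T0.
have GT_fin : (\int[P]_w (G T w)%:E < +oo)%E by rewrite integral_G ?ltry.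
have adapted_upto t : 0 <= t <= T ->
    measurable_fun setT (G t : g_sigma_algebraType (Gen t) -> R).
  by case/andP => t0 _; exact: G_adapted.
have martingale_upto t A : 0 <= t <= T -> <<s Gen t >> A ->
    (\int[P]_(w in A) (G t w)%:E = \int[P]_(w in A) (G T w)%:E)%E.
  by case/andP => t0 tT; exact: G_martingale.
have thetaT w : 0 <= theta T w <= T by exact: theta_itv.
have stopT t : 0 <= t -> <<s Gen t >> [set w | theta T w <= t] by exact: theta_stopping.
have H := @optional_stopping R d Omega P Gen T G (theta T) T0 Gen_sub Gen_mono
  adapted_upto G_ge0 G_rc GT_fin martingale_upto thetaT stopT.
exact: etrans H (integral_G T0').
Qed.

Let disc (s : R) : R := expR (- (r * s)).

Let disc_rate f : bounded_rate cbar f -> bounded_rate cbar (fun s => disc s * f s).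
Proof.
move=> fc; have [me e1] := exp_rate r_gt0; split.
  by apply: measurable_funM; [exact: me|exact: fc.1].
move=> s s0; have /andP[f0 fle] := fc.2 s s0; have /andP[e0 ele] := e1 s s0.
by rewrite mulr_ge0//= (le_trans _ fle)// ler_piMl.
Qed.

Let X_ge0 (s : R) w : 0 <= s -> (s%:E <= tau w)%E -> 0 <= X s w.
Proof.
move=> s0 st; have X0w : 0 <= X 0 w by rewrite X0.
exact: (@hitting_time_le_ge0 _ (X^~ w) s (@X_continuous w) X0w s0 st).
Qed.

(** Dividends and shortfall add up to [cbar], so together they are the perpetuity cut at [t]. *)
Let primitive_disc_split (t : R) w : 0 <= t ->
  primitive (fun s => disc s * C s w) t + primitive (fun s => disc s * a s w) t
    = K * (1 - disc t).
Proof.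
move=> t0.
have muy : (leb (`[0%R, t]%classic : set R) < +oo)%E.
  by rewrite lebesgue_measure_itv /=; case: ifP => // _; rewrite -EFinD ltry.
have pos : (`[0, t]%classic : set R) `<=` [set s | 0 <= s].
  by move=> s; rewrite /= in_itv /= => /andP[].
rewrite -(primitive_exp r_gt0 t0) mulrA divfK ?gt_eqF// /primitive -RintegralD//; last 2 first.
- exact: bounded_rate_integrable (disc_rate (C_rate w)) pos muy.
- exact: bounded_rate_integrable (disc_rate (a_rate w)) pos muy.
rewrite -RintegralZl//; last exact: bounded_rate_integrable (exp_rate r_gt0) pos muy.
by apply: eq_Rintegral => s _; rewrite /a /disc; ring.
Qed.

Let path_payoff w : \bar R :=
  (\int[leb]_(t in [set t : R | (0 <= t)%R /\ (t%:E <= tau w)%E])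
    (expR (- (r * t)) * C t w)%R%:E)%E.

Hypothesis gK : cbar * g <= r.

Let stopped_G_le (T : R) w : 0 <= T ->
  K * stopped_G T w <= K * disc (theta T w) + primitive (fun s => disc s * a s w) (theta T w).
Proof.
move=> T0; have /andP[th0 thT] := theta_itv w T0.
(* Here the smallness of the cap enters: the weight of the time integral is at most 1. *)
have Kg : K * g <= 1 by rewrite mulrAC ler_pdivrMr// mul1r.
have Z_le (s : R) : 0 <= s -> s <= theta T w -> Z s w <= disc s.
  move=> s0 sth; rewrite ZE// ler_expR gerBl mulr_ge0// X_ge0//.
  by apply: le_trans (theta_le_tau w T0); rewrite lee_fin.
have Z0 s : 0 <= Z s w by apply: discounted_ge0 => *; exact: N_ge0.
rewrite /stopped_G /G /compensated mulrDr lerD//.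
  by rewrite ler_wpM2l//; exact: Z_le.
have flow_int := discounted_flow_integrable Gen_sub Gen_mono N_ge0 N_adapted N_rc
  N_bounded a_adapted a_rc a_itv g_ge0 w th0.
have pos : (`[0, theta T w]%classic : set R) `<=` [set s | 0 <= s].
  by move=> s; rewrite /= in_itv /= => /andP[].
have muy : (leb (`[0%R, theta T w]%classic : set R) < +oo)%E.
  by rewrite lebesgue_measure_itv /=; case: ifP => // _; rewrite -EFinD ltry.
rewrite mulrA /primitive -RintegralZl//; apply: le_Rintegral => //.
- rewrite (_ : _ \o _ = fun s => ((K * g)%:E * (discounted N a g s w * a s w)%:E)%E)//.
  exact: integrableZl.
- exact: bounded_rate_integrable (disc_rate (a_rate w)) pos muy.
move=> s; rewrite /= in_itv /= => /andP[s0 sth].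
have /andP[a0 _] := a_itv w s0.
rewrite mulrA ler_wpM2r//; apply: le_trans (Z_le s s0 sth).
by rewrite ler_piMl.
Qed.

(** Up to [theta] the dividends are the truncated perpetuity minus the shortfall, which
    [stopped_G_le] controls. What a path surviving beyond [T] still pays is at most the tail
    [K * disc T] of the perpetuity. *)
Let path_payoff_le (T : R) w : 0 < T ->
  (path_payoff w <= (K + K * disc T - K * stopped_G T w)%:E)%E.
Proof.
move=> T0; have T0' := ltW T0; have /andP[th0 thT] := theta_itv w T0'.
have Cdisc := disc_rate (C_rate w).
pose f (s : R) : \bar R := (disc s * C s w)%:E.
pose h (s : R) : \bar R := (disc s * cbar)%:E.
have disc0 s : 0 <= disc s by exact: expR_ge0.
have h0 s : (0 <= h s)%E by rewrite lee_fin mulr_ge0// ltW.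
have mh : measurable_fun setT h.
  apply/measurable_EFinP; apply: measurable_funM => //.
  apply: measurableT_comp => //; apply: measurableT_comp => //; exact: measurable_funM.
have mf : measurable_fun (`[0%R, theta T w]%classic : set R) f.
  apply/measurable_EFinP; apply: measurable_funS Cdisc.1 => //.
  by move=> s; rewrite /= !in_itv /= => /andP[-> _].
have f0 s : 0 <= s -> (0 <= f s)%E by move=> s0; case/andP: (Cdisc.2 s s0).
have le1 : (path_payoff w <= \int[leb]_(s in `[0%R, theta T w]) f s
    + \int[leb]_(s in `]T, +oo[) h s)%E.
  rewrite [X in (X + _)%E]integral_mkcond [X in (_ + X)%E]integral_mkcond.
  rewrite -ge0_integralD//; last 4 first.
  - move=> s _; apply: erestrict_ge0 => u; rewrite /= in_itv /= => /andP[u0 _]; exact: f0.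
  - exact/(measurable_restrictT _ _).1.
  - by move=> s _; exact: erestrict_ge0.
  - by apply/(measurable_restrictT _ _).1 => //; exact: measurable_funTS.
  rewrite /path_payoff [leLHS]integral_mkcond; 
  apply: (@ge0_le_integral_nonmeasurable _ _ _ leb setT) => s _.
    by apply: erestrict_ge0 => u [u0 _]; exact: f0.
  have g1 : (0 <= (f \_ `[0%R, theta T w]) s)%E.
    by apply: erestrict_ge0 => u; rewrite /= in_itv /= => /andP[u0 _]; exact: f0.
  have g2 : (0 <= (h \_ `]T, +oo[) s)%E by exact: erestrict_ge0.
  rewrite patchE; case: ifPn => [|_]; last exact: adde_ge0.
  rewrite inE /= => -[s0 stau].
  have [sth|ths] := leP s (theta T w).
    by rewrite [in leRHS]patchE mem_set ?leeDl//= in_itv /= s0.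
  (* A time beyond [theta T w] but not beyond ruin lies past the horizon, since [theta T w] is then
     [T]. *)
  have Ts : T < s.
    rewrite -lte_fin; move: ths; rewrite -lte_fin thetaE// gt_min.
    by rewrite ltNge stau.
  rewrite (patchE h) (mem_set (A := `]T, +oo[%classic)); last first.
    by rewrite /= in_itv /= Ts.
  apply: le_trans (_ : h s <= _)%E; last by rewrite leeDr.
  by rewrite lee_fin ler_wpM2l//; case/andP: (C_itv w s0).
apply: (le_trans le1).
have tail : (\int[leb]_(s in `]T, +oo[) h s <= (K * disc T)%:E)%E.
  rewrite (_ : integral _ _ _ = \int[leb]_(s in `]T, +oo[)
      (K%:E * (r * expR (- (r * s)))%:E))%E; last first.
    apply: eq_integral => s _; rewrite /h -EFinM mulrA divfK ?gt_eqF//.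
    by rewrite /disc mulrC.
  rewrite ge0_integralZl_EFin//.
    by rewrite [leRHS]EFinM; apply: lee_wpmul2l; [rewrite lee_fin|exact: exp_tail].
    by move=> s _; rewrite lee_fin mulr_ge0 ?expR_ge0// ltW.
  apply/measurable_EFinP; apply: measurable_funM => //; apply: measurable_funTS.
  by apply: measurableT_comp => //; apply: measurableT_comp => //; exact: measurable_funM.
apply: (le_trans (leeD2l _ tail)).
rewrite -(EFin_primitive Cdisc th0) -EFinD lee_fin.
have := stopped_G_le w T0'; have := primitive_disc_split w th0.
move: (K * stopped_G T w) (primitive _ _) (primitive _ _) (disc (theta T w)) => *.
by lra.
Qed.

Let path_payoff_ge0 w : (0 <= path_payoff w)%E.
Proof.
apply: integral_ge0 => t [t0 _]; rewrite lee_fin mulr_ge0 ?expR_ge0//.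
by case/andP: (C_itv w t0).
Qed.

Let disc_small (e : R) : 0 < e -> exists2 T : R, 0 < T & K * disc T <= e.
Proof.
move=> e0; have Kpos : 0 < K by rewrite divr_gt0.
(* This makes the exponent [K / e], and [K / e <= expR (K / e)] is the required bound. *)
exists (K / (r * e)); first by rewrite divr_gt0// mulr_gt0.
have rn0 : r != 0 by rewrite gt_eqF.
have en0 : e != 0 by rewrite gt_eqF.
have -> : disc (K / (r * e)) = expR (- (K / e)).
  by rewrite /disc; congr expR; field; rewrite rn0 en0.
rewrite expRN ler_pdivrMr ?expR_gt0// -ler_pdivrMl// mulrC.
by apply: le_trans (expR_ge1Dx _); rewrite lerDr.
Qed.

Let measurable_KG (T : R) : 0 < T -> measurable_fun setT (fun w => K * stopped_G T w).
Proof. by move=> T0; apply: measurable_funM => //; exact: measurable_stopped_G. Qed.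

Let KG_ge0 T w : 0 <= K * stopped_G T w.
Proof. by apply: mulr_ge0 => //; exact: G_ge0. Qed.

Let integral_KG (T : R) : 0 < T ->
  (\int[P]_w (K * stopped_G T w)%:E = (K * expR (- (g * x)))%:E)%E.
Proof.
move=> T0; under eq_integral do rewrite EFinM.
rewrite ge0_integralZl_EFin//.
- by rewrite integral_stopped_G// -EFinM.
- by move=> w _; rewrite lee_fin; exact: G_ge0.
- by apply/measurable_EFinP; exact: measurable_stopped_G.
Qed.

Lemma payoff_le : (payoff P W mu sigma r x C <= (K * (1 - expR (- (g * x))))%:E)%E.
Proof.
apply/lee_addgt0Pr => e e0; have [T T0 KT] := disc_small e0.
pose h w := K + K * disc T - K * stopped_G T w.
have mh : measurable_fun setT h by apply: measurable_funB => //; exact: measurable_KG.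
have h0 w : 0 <= h w by rewrite -lee_fin (le_trans (path_payoff_ge0 w))// path_payoff_le.
(* The integral of [h] is found by adding [K * stopped_G T] back, so that only nonnegative
   integrands are combined. *)
have hE : (\int[P]_w (h w)%:E + (K * expR (- (g * x)))%:E = (K + K * disc T)%:E)%E.
  rewrite -(integral_KG T0) -ge0_integralD//; first last.
  - by apply/measurable_EFinP; exact: measurable_KG.
  - by move=> w _; rewrite lee_fin; exact: KG_ge0.
  - exact/measurable_EFinP.
  - by move=> w _; rewrite lee_fin.
  under eq_integral do rewrite -EFinD subrK.
  by rewrite integral_cst//= probability_setT mule1.
apply: (@le_trans _ _ (\int[P]_w (h w)%:E)%E).
  apply: ge0_le_integral_nonmeasurable => w _; [exact: path_payoff_ge0|exact: path_payoff_le].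
move: hE; case: (integral _ _ _) => [v| |]//.
rewrite -EFinD => -[hE]; rewrite -EFinD lee_fin; move: hE KT.
by rewrite mulrBr mulr1; lra.
Qed.

Lemma payoff_ge_constant : (forall t w, C t w = cbar) ->
  ((K * (1 - expR (- (g * x))))%:E <= payoff P W mu sigma r x C)%E.
Proof.
move=> C_cst; apply/lee_addgt0Pr => e e0; have [T T0 KT] := disc_small e0.
have T0' := ltW T0.
(* The lower bound may be negative; cutting it at 0 allows comparison with the nonnegative path
   payoff and only raises it. *)
pose m w := Num.max 0 (K - K * stopped_G T w - K * disc T).
have m0 w : 0 <= m w by rewrite le_max lexx.
have mm : measurable_fun setT m.
  apply: measurable_maxr => //; apply: measurable_funB => //; apply: measurable_funB => //.
  exact: measurable_KG.
have m_le w : ((m w)%:E <= path_payoff w)%E.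
  rewrite EFin_max ge_max path_payoff_ge0 /=.
  have /andP[th0 thT] := theta_itv w T0'.
  have Cdisc := disc_rate (C_rate w).
  apply: (@le_trans _ _ (primitive (fun s => disc s * C s w) (theta T w))%:E).
    have := primitive_disc_split w th0.
    rewrite [X in _ + X = _](_ : _ = 0); last first.
      rewrite /primitive (_ : (fun s => _) = cst 0) ?Rintegral_cst ?mul0r//.
      by apply/funext => s; rewrite /a C_cst subrr mulr0.
    rewrite addr0 => ->; rewrite lee_fin.
    suff /(ler_wpM2l K_ge0) : disc (theta T w) <= stopped_G T w + disc T.
      by rewrite mulrDr mulrBr mulr1; lra.
    have dT0 : 0 <= disc T by exact: expR_ge0.
    have sG0 : 0 <= stopped_G T w by exact: G_ge0.
    (* Without ruin by [T] the term [disc T] alone covers the left side. With ruin by [T] the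
       surplus at [theta] is nonpositive, so [Z] is at least the discount factor there. *)
    have [tauT|Ttau] := leP (tau w) T%:E; last first.
      suff -> : theta T w = T by rewrite lerDr.
      by apply: EFin_inj; rewrite thetaE// min_r// ltW.
    have tauE : tau w = (theta T w)%:E by rewrite thetaE// min_l.
    have Xth : X (theta T w) w <= 0 by exact: hitting_time_attained (@X_continuous w) tauE.
    rewrite -[leLHS]addr0 lerD//.
    apply: (@le_trans _ _ (Z (theta T w) w)).
      by rewrite ZE// ler_expR lerDl oppr_ge0 mulr_ge0_le0.
    rewrite /stopped_G /G /compensated lerDl mulr_ge0//; apply: Rintegral_ge0 => s.
    rewrite /= in_itv /= => /andP[s0 _]; apply: mulr_ge0; last by case/andP: (a_itv w s0).
    by apply: discounted_ge0 => *; exact: N_ge0.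
  rewrite (EFin_primitive Cdisc th0) integral_mkcond [leRHS]integral_mkcond.
  apply: ge0_le_integral_nonmeasurable => s _.
    apply: erestrict_ge0 => u; rewrite /= in_itv /= => /andP[u0 _].
    by rewrite lee_fin; case/andP: (Cdisc.2 u u0).
  rewrite [leLHS]patchE; case: ifPn => [|_].
    rewrite inE /= in_itv /= => /andP[s0 sth].
    rewrite patchE mem_set//; split => //; apply: le_trans (theta_le_tau w T0').
    by rewrite lee_fin.
  apply: erestrict_ge0 => u [u0 _]; rewrite lee_fin.
  by case/andP: (Cdisc.2 u u0).
have intm : (\int[P]_w (m w)%:E <= payoff P W mu sigma r x C)%E.
  by apply: ge0_le_integral_nonmeasurable => w _; [rewrite lee_fin|exact: m_le].
apply: le_trans (leeD2r _ intm).
(* Stated as a sum, since the integral of [m] is not yet known to be finite. *)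
have : (K%:E <= \int[P]_w (m w)%:E + (K * expR (- (g * x)))%:E + (K * disc T)%:E)%E.
  rewrite -(integral_KG T0) -ge0_integralD//; first last.
  - by apply/measurable_EFinP; exact: measurable_KG.
  - by move=> w _; rewrite lee_fin; exact: KG_ge0.
  - exact/measurable_EFinP.
  - by move=> w _; rewrite lee_fin.
  have cstE k : (\int[P]_w (cst k%:E w) = k%:E)%E.
    by rewrite integral_cst//= probability_setT mule1.
  rewrite -(cstE (K * disc T)) -ge0_integralD//; first last.
  - by move=> w _; rewrite lee_fin mulr_ge0 ?expR_ge0.
  - apply: emeasurable_funD; first exact/measurable_EFinP.
    by apply/measurable_EFinP; exact: measurable_KG.
  - by move=> w _; rewrite adde_ge0 ?lee_fin.
  rewrite -{1}(cstE K); apply: ge0_le_integral_nonmeasurable => w _; first by rewrite lee_fin.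
  rewrite /= -!EFinD lee_fin /m; have : K - K * stopped_G T w - K * disc T <= m w.
    by rewrite le_max lexx orbT.
  by rewrite /m; lra.
case: (integral _ _ _) => [v| |]// Hle; last by rewrite addye// leey.
move: Hle; rewrite -!EFinD !lee_fin mulrBr mulr1; lra.
Qed.

End bounded_dividends.

(** * The optimal value *)

Section clipping.
Context {R : realType} {d : measure_display} {Omega : measurableType d}.
Variables (P : probability Omega R) (W : R -> Omega -> R) (mu sigma r cbar b x c : R).
Hypotheses (cbar_gt0 : 0 < cbar) (b_ge0 : 0 <= b) (c_ge0 : 0 <= c).

Definition clip (k y : R) : R := Num.max 0 (Num.min y k).

Lemma clip_itv k y : 0 <= k -> 0 <= clip k y <= k.
Proof. by move=> k0; rewrite le_max lexx /= ge_max k0 ge_min lexx orbT. Qed.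

Lemma clip_id k y : 0 <= y <= k -> clip k y = y.
Proof. by move=> /andP[y0 yk]; rewrite /clip min_l// max_r. Qed.

(** This carries right continuity of the paths over to the clipped rate. *)
Lemma clip_lipschitz k y z : 0 <= k -> `|clip k y - clip k z| <= `|y - z|.
Proof.
move=> k0.
have clipE u : [\/ u <= 0 /\ clip k u = 0, 0 <= u <= k /\ clip k u = u |
    k <= u /\ clip k u = k].
  have [u0|u0] := leP u 0.
    by apply: Or31; split => //; rewrite /clip max_l// ge_min u0.
  have [uk|uk] := leP u k.
    by apply: Or32; rewrite clip_id ?(ltW u0).
  by apply: Or33; split; [exact: ltW|rewrite /clip (min_r (ltW uk)) max_r].
have h1 := ler_norm (y - z); have h2 := ler_norm (z - y); rewrite distrC in h2.
have h3 := normr_ge0 (y - z).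
rewrite ler_norml; move: h1 h2 h3; move: `|y - z| => q h1 h2 h3.
by case: (clipE y) => -[hy ->]; case: (clipE z) => -[hz ->]; apply/andP; split; lra.
Qed.

Lemma admissible_itv C w t : admissible P W mu sigma cbar b x c C -> 0 <= t ->
  (t%:E <= ruin_time W mu sigma x C w)%E -> 0 <= C t w <= cbar.
Proof.
move=> [_ _ bnd] t0 /(bnd w t t0)/andP[lo ->]; rewrite andbT.
apply: le_trans lo; apply: mulr_ge0 => //.
(* The maximum with [c] ensures nonnegativity whatever value [sup] takes. *)
by rewrite /running_max le_max c_ge0.
Qed.

(** Before the ruin of [C] clipping changes nothing, so the two surpluses coincide and neither is
    ruined. This direction is the one that enlarges the payoff. *)
Lemma ruin_time_clip C w : admissible P W mu sigma cbar b x c C ->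
  (ruin_time W mu sigma x C w <= ruin_time W mu sigma x (fun t w => clip cbar (C t w)) w)%E.
Proof.
move=> adm; apply: le_ereal_inf_tmp => _ [t [t0 Xt] <-].
rewrite leNgt; apply/negP => tlt.
have := lt_hitting_time t0 tlt; rewrite ltNge => /negP; apply.
apply: le_trans Xt; rewrite le_eqVlt; apply/orP; left; apply/eqP.
rewrite /surplus; congr (_ + _ + _); apply: eq_Rintegral => s.
rewrite inE /= in_itv /= => /andP[s0 st]; rewrite clip_id//.
apply: (admissible_itv adm s0); apply: le_trans (ltW tlt); by rewrite lee_fin.
Qed.

(** Up to the ruin of [C] both rates agree; any later dividend of the clipped rate is
    nonnegative. *)
Lemma payoff_clip C : admissible P W mu sigma cbar b x c C ->
  (payoff P W mu sigma r x C <= payoff P W mu sigma r x (fun t w => clip cbar (C t w)))%E.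
Proof.
move=> adm; have cbar0 := ltW cbar_gt0.
apply: ge0_le_integral_nonmeasurable => w _.
  apply: integral_ge0 => t [t0 tt]; rewrite lee_fin mulr_ge0 ?expR_ge0//.
  by case/andP: (admissible_itv adm t0 tt).
rewrite integral_mkcond [leRHS]integral_mkcond.
apply: ge0_le_integral_nonmeasurable => t _.
  apply: erestrict_ge0 => s [s0 st]; rewrite lee_fin mulr_ge0 ?expR_ge0//.
  by case/andP: (admissible_itv adm s0 st).
rewrite [leLHS]patchE; case: ifPn => [|_].
  rewrite inE /= => -[t0 tt]; rewrite patchE mem_set; last first.
    by split => //; apply: le_trans tt _; exact: ruin_time_clip.
  by rewrite clip_id//; exact: admissible_itv adm t0 tt.
apply: erestrict_ge0 => s [s0 st]; rewrite lee_fin mulr_ge0 ?expR_ge0//.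
by case/andP: (clip_itv (C s w) cbar0).
Qed.

End clipping.

Unset Implicit Arguments.

Theorem theorem4p1 (R : realType) (d : measure_display) (Omega : measurableType d)
  (P : probability Omega R) (W : R -> Omega -> R) (mu sigma r cbar b : R) :
  standard_BM P W ->
  0 < sigma -> 0 < r -> 0 < cbar -> cbar <= mu -> 0 <= b -> b <= 1 ->
  2 * mu * cbar <= sigma ^+ 2 * r ->
  forall x c : R, 0 <= x -> 0 <= c -> c <= cbar ->
    value_fun P W mu sigma r cbar b x c
      = (cbar / r * (1 - expR (- (gamma_const mu sigma cbar r * x))))%:E
    /\ admissible P W mu sigma cbar b x c (fun _ _ => cbar)
    /\ payoff P W mu sigma r x (fun _ _ => cbar) = value_fun P W mu sigma r cbar b x c.
Proof.
move=> BM sigma0 r0 cbar0 cbar_mu b0 b1 drift x c x0 c0 c_cbar.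
have cbar0' := ltW cbar0.
have gK : cbar * gamma_const mu sigma cbar r <= r by exact: gamma_const_le.
set v := (cbar / r * _).
pose Cstar (t : R) (w : Omega) := cbar.
have bound C : adapted (aug_filtration P W) C -> right_continuous_paths C ->
    (forall (t : R) w, 0 <= t -> 0 <= C t w <= cbar) ->
    (payoff P W mu sigma r x C <= v%:E)%E.
  by move=> *; apply: payoff_le.
have Cstar_adapted : adapted (aug_filtration P W) Cstar.
  move=> t t0 B mB; rewrite -[_ @^-1` _]setTI.
  exact: (@measurable_cst _ _ (g_sigma_algebraType (aug_gen P W t)) R setT cbar).
have Cstar_rc : right_continuous_paths Cstar by move=> w t t0; exact: cvg_cst.
have Cstar_itv (t : R) w : 0 <= t -> 0 <= Cstar t w <= cbar.
  by move=> _; rewrite cbar0' lexx.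
have adm : admissible P W mu sigma cbar b x c Cstar.
  split => //.
  - by move=> w t t0; split; [exact: cvg_cst|exists cbar; exact: cvg_cst].
  (* The running maximum equals [cbar] because [c <= cbar], and [b <= 1] then gives the lower
     constraint. *)
  - move=> w t t0 _; rewrite lexx andbT /running_max.
    rewrite (_ : [set _ | _ in _] = [set cbar]); last first.
      apply/seteqP; split => [_ [s _ <-]//|_ ->]; exists 0 => //.
      by rewrite /= in_itv /= lexx.
    by rewrite sup1 max_r// ler_piMl.
have star : payoff P W mu sigma r x Cstar = v%:E.
  apply/le_anti/andP; split; first exact: bound.
  exact: (payoff_ge_constant x BM sigma0 r0 cbar0 cbar_mu Cstar_adapted Cstar_rc Cstar_itv).
have valE : value_fun P W mu sigma r cbar b x c = v%:E.
  apply/le_anti/andP; split.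
    apply: ge_ereal_sup => _ [C admC <-].
    (* The clipped rate lies in [[0, cbar]] at all nonnegative times; with adaptedness and right
       continuity this is what [bound] asks. *)
    apply: (le_trans (payoff_clip r cbar0 b0 c0 admC)); apply: bound.
    - move=> t t0 B mB; rewrite -[_ @^-1` _]setTI.
      have [adC _ _] := admC.
      have mC : measurable_fun setT (C t : g_sigma_algebraType (aug_gen P W t) -> R).
        by move=> _ D mD; rewrite setTI; exact: adC.
      have mclip : measurable_fun setT
          ((fun w => clip cbar (C t w)) : g_sigma_algebraType (aug_gen P W t) -> R).
        by apply: measurable_maxr => //; exact: measurable_minr.
      exact: mclip.
    - move=> w t t0; have [_ cC _] := admC; have [rC _] := cC w t t0.
      apply/cvgrPdist_le => e e0.
      move/cvgrPdist_le : rC => /(_ e e0); apply: filterS => s.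
      by apply: le_trans; exact: clip_lipschitz.
    - by move=> t w _; exact: clip_itv.
  by rewrite -star; apply: ereal_sup_ubound; exists Cstar.
by rewrite valE; split => //; split.
Qed.
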